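(* Let $p(\cdot),q(\cdot)\in\mathcal{P}$ with $p_+<\infty$, $q_+<\infty$, $1<(p/q)_-$ and $\frac{p(\cdot)}{q(\cdot)}\in LH(\mathbb{R}^n)$. Then the approximation identity holds in $V$: for every potential type approximation identity $\{\phi_t\}_{t>0}$ and every $g\in V$, $$\lim_{t\to0}\,(\phi_t*g)(x)=g(x)\quad\text{for almost every }x\in\mathbb{R}^n,$$ i.e. $\lim_{t\to0}|(\phi_t*g)(x)-g(x)|=0$ for almost every $x$.
   Context: Exponents: $\mathcal{P}$ is the set of measurable functions $p(\cdot):\mathbb{R}^n\to[1,\infty]$; for an exponent $r(\cdot)$, $r_-=\operatorname{ess\,inf}r$, $r_+=\operatorname{ess\,sup}r$; $(p/q)_\pm$ are those of $p(\cdot)/q(\cdot)$. $r(\cdot)\in LH(\mathbb{R}^n)$ means: there is $C_0$ with $|r(x)-r(y)|\le \frac{C_0}{-\log|x-y|}$ whenever $|x-y|<\frac12$, and there are $C_\infty$ and $r_\infty$ with $|r(x)-r_\infty|\le\frac{C_\infty}{\log(e+|x|)}$ for all $x\in\mathbb{R}^n$. For a measurable exponent $r(\cdot)$ with values in $[c,\infty)$, $c>0$: $\varrho_{r(\cdot)}(f)=\int_{\mathbb{R}^n}|f(x)|^{r(x)}dx$, $\|f\|_{r(\cdot)}=\inf\{\lambda>0:\varrho_{r(\cdot)}(f/\lambda)\le1\}$, and $L^{r(\cdot)}$ is the space of measurable $f$ on $\mathbb{R}^n$ with $\varrho_{r(\cdot)}(f/\lambda)<\infty$ for some $\lambda>0$.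 The space $V$: $V=\{g=(f_\nu^{q(\cdot)})_{\nu\ge1}: f_\nu\in L^{p(\cdot)}\ \forall\nu,\ \|g\|_V<\infty\}$, where $\|g\|_V=\|(f_\nu^{q(\cdot)})_\nu\|_{\ell^1(L^{p(\cdot)/q(\cdot)})}=\sum_{\nu=1}^\infty\|f_\nu^{q(\cdot)}\|_{p(\cdot)/q(\cdot)}$. Here $f^{q(\cdot)}$ denotes the signed power $x\mapsto f(x)|f(x)|^{q(x)-1}$, so that $f^{q(\cdot)}\in L^{p(\cdot)/q(\cdot)}$ iff $f\in L^{p(\cdot)}$, and $V$ is the space $\ell^1(L^{p(\cdot)/q(\cdot)})$. For a function $\phi$ on $\mathbb{R}^n$ and $t>0$, $\phi_t(x)=t^{-n}\phi(x/t)$. If $\phi\in L^1$ and $\int\phi=1$, $\{\phi_t\}_{t>0}$ is an approximation identity; it is of potential type if in addition the radial majorant $\Phi(x)=\sup_{|y|>|x|}|\phi(y)|$ belongs to $L^1$. For a sequence $g=(g_\nu)_\nu$, $\phi_t*g=(\phi_t*g_\nu)_\nu$ and $|g(x)|=\big(\sum_\nu|g_\nu(x)|^2\big)^{1/2}$. *)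

(* Defs.v *)
From HB Require Import structures.
From mathcomp Require Import all_boot all_order all_algebra.
From mathcomp Require Import all_classical all_reals all_analysis.
From mathcomp Require Import measurable_realfun ess_sup_inf.

Set Implicit Arguments.
Unset Strict Implicit.
Unset Printing Implicit Defensive.

Import Order.TTheory GRing.Theory Num.Theory.
Import numFieldNormedType.Exports.

Local Open Scope classical_set_scope.
Local Open Scope ring_scope.

(* The library has no n-dimensional Lebesgue measure. It is built here as the
   library builds the complete one-dimensional one: an outer measure (infimum
   of total volumes over countable covers by half-open boxes), restricted to
   its Caratheodory-measurable sets. The dimension is n.+1, so that R^0 is
   excluded. *)
Section lebesgue_outer_measure.
Context {R : realType} {n : nat}.

Definition obox (c : 'rV[R]_n.+1 * 'rV[R]_n.+1) : set 'rV[R]_n.+1 :=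
  [set x | forall i, c.1 0 i < x 0 i <= c.2 0 i].

Definition obox_vol (c : 'rV[R]_n.+1 * 'rV[R]_n.+1) : R :=
  \prod_(i < n.+1) Num.max 0 (c.2 0 i - c.1 0 i).

Definition obox_cover (A : set 'rV[R]_n.+1) :
    set (nat -> 'rV[R]_n.+1 * 'rV[R]_n.+1) :=
  [set c | A `<=` \bigcup_k obox (c k)].

Local Open Scope ereal_scope.

Definition leb_outer (A : set 'rV[R]_n.+1) : \bar R :=
  ereal_inf [set \sum_(0 <= k <oo) (obox_vol (c k))%:E | c in obox_cover A].

Lemma obox_vol_ge0 c : 0 <= (obox_vol c)%:E.
Proof. by rewrite lee_fin; apply: prodr_ge0 => i _; rewrite le_max lexx. Qed.
#[local] Hint Resolve obox_vol_ge0 : core.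

Lemma leb_outer_ge0 A : 0 <= leb_outer A.
Proof. by apply: le_ereal_inf_tmp => _ [c _ <-]; exact: nneseries_ge0. Qed.

Lemma le_leb_outer : {homo leb_outer : A B / A `<=` B >-> A <= B}.
Proof.
move=> A B AB; apply: ereal_inf_le_tmp => _ [c Bc <-].
by exists c => //; exact: subset_trans AB Bc.
Qed.

Lemma leb_outer0 : leb_outer set0 = 0.
Proof.
apply/eqP; rewrite eq_le leb_outer_ge0 andbT; apply: ereal_inf_lbound.
exists (fun=> (0%R, 0%R)); first exact: sub0set.
apply: eseries0 => k _ _; congr EFin; rewrite /obox_vol big_ord_recl /=.
by rewrite !mxE subrr maxxx mul0r.
Qed.

Lemma leb_outer_sigma_subadditive : sigma_subadditive leb_outer.
Proof.
move=> A; have [[i ioo]|] := pselect (exists i, leb_outer (A i) = +oo).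
  rewrite (eseries_pinfty _ _ ioo) ?leey// => m _.
  by rewrite -ltNye (lt_le_trans _ (leb_outer_ge0 _)).
rewrite -forallNE => Aoo.
suff add2e (e : {posnum R}) : leb_outer (\bigcup_m A m) <=
    \sum_(i <oo) leb_outer (A i) + e%:num%:E.
  by apply/lee_addgt0Pr => _/posnumP[].
rewrite (le_trans _ (epsilon_trick _ _ _))//; last first.
  by move=> m; exact: leb_outer_ge0.
pose mu c := (obox_vol c)%:E.
pose P m B := obox_cover (A m) B /\
  \sum_(k <oo) mu (B k) <= leb_outer (A m) + (e%:num / (2 ^ m.+1)%:R)%:E.
have [G PG] : {G & forall m, P m (G m)}.
  apply: (@choice _ _ P) => m; rewrite /P /leb_outer.
  set S := (X in ereal_inf X); move infS : (ereal_inf S) => iS.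
  case: iS infS => [r Sr|Soo|Soo].
  - have en1 : (0 < e%:num / (2 ^ m.+1)%:R)%R by [].
    have /(lb_ereal_inf_adherent en1) : ereal_inf S \is a fin_num by rewrite Sr.
    move=> [x [B AmB muBx] xS].
    by exists B; split => //; rewrite muBx -Sr; exact/ltW.
  - by have := Aoo m; rewrite /leb_outer Soo.
  - suff : lbound S 0 by move/le_ereal_inf_tmp; rewrite Soo.
    by move=> /= _ [B AmB <-]; exact: nneseries_ge0.
have muG_ge0 x : 0 <= (mu \o uncurry G) x by exact: obox_vol_ge0.
apply: (@le_trans _ _ (\esum_(i in setT) (mu \o uncurry G) i)).
  apply: ereal_inf_lbound => /=.
  have /card_esym/ppcard_eqP[f] := card_nat2.
  exists (uncurry G \o f).
    move=> t [i _ /(PG i).1 [j _ ?]].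
    by exists (f^-1%FUN (i, j)) => //=; rewrite invK ?inE.
  rewrite -(esum_pred_image (mu \o uncurry G) _ xpredT) ?[fun=> _]set_true//.
  by rewrite image_eq.
rewrite (_ : esum _ _ = \sum_(i <oo) \sum_(j <oo ) mu (G i j)); last first.
  pose J : nat -> set (nat * nat) := fun i => [set (i, j) | j in setT].
  rewrite (_ : setT = \bigcup_k J k); last first.
    by rewrite predeqE => -[a b]; split => // _; exists a => //; exists b.
  rewrite esum_bigcupT /=; last 2 first.
    - apply/trivIsetP => i j _ _ ij.
      rewrite predeqE => -[k m] /=; split => //= -[] [_] _ [<-{k} _].
      by move=> [m' _] [] /esym/eqP; rewrite (negbTE ij).
    - by move=> /= [k m]; exact: obox_vol_ge0.
  rewrite -(image_id [set: nat]) -fun_true esum_pred_image//; last first.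
    by move=> k _; apply: esum_ge0 => ? _; exact: obox_vol_ge0.
  apply: eq_eseriesr => /= j _.
  rewrite -(esum_pred_image (mu \o uncurry G) (pair j) predT)/=; last 2 first.
    - by move=> ? _; exact: obox_vol_ge0.
    - by move=> ? ? _ _; exact: (@can_inj _ _ _ snd).
  by congr esum; rewrite predeqE => -[a b]; split; move=> [i _ <-]; exists i.
apply: lee_lim.
- apply: is_cvg_nneseries => k *.
  by apply: nneseries_ge0 => m *; exact: (muG_ge0 (k, m)).
- by apply: is_cvg_nneseries => k *; apply: adde_ge0 => //; exact: leb_outer_ge0.
- by near=> k; apply: lee_sum => i _; exact: (PG i).2.
Unshelve. all: by end_near. Qed.

HB.instance Definition _ := isOuterMeasure.Build R 'rV[R]_n.+1 leb_outer
  leb_outer0 leb_outer_ge0 le_leb_outer leb_outer_sigma_subadditive.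

End lebesgue_outer_measure.

Definition leb_outer_measure (R : realType) (n : nat) :
  {outer_measure set 'rV[R]_n.+1 -> \bar R} := @leb_outer R n.

(* 'rV[R]_n.+1 with the Lebesgue sigma-algebra; the two types are convertible *)
Definition leb_space (R : realType) (n : nat) : Type :=
  caratheodory_type (leb_outer_measure R n).

Definition leb {R : realType} {n : nat} :
    {measure set (leb_space R n) -> \bar R} :=
  (leb_outer_measure R n : set (caratheodory_type (leb_outer_measure R n)) -> _).

Definition enorm {R : realType} {n : nat} (x : 'rV[R]_n.+1) : R :=
  Num.sqrt (\sum_(i < n.+1) x 0 i ^+ 2).

Section variable_exponents.
Context {R : realType} {n : nat}.
Local Open Scope ereal_scope.

Definition exponent (p : 'rV[R]_n.+1 -> \bar R) : Prop :=
  measurable_fun [set: leb_space R n] p /\ (forall x, 1 <= p x).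

(* The library's convention is +oo / +oo = 0. *)
Definition quot_exp (p q : 'rV[R]_n.+1 -> \bar R) : 'rV[R]_n.+1 -> \bar R :=
  fun x => p x / q x.

(* ln 0 = 0 and 0^-1 = 0, so the local bound reads 0 <= 0 at x = y. *)
Definition log_holder (r : 'rV[R]_n.+1 -> \bar R) : Prop :=
  (exists C0 : R, forall x y : 'rV[R]_n.+1, (enorm (x - y) < 2^-1)%R ->
     `|r x - r y| <= (C0 / - ln (enorm (x - y)))%:E) /\
  (exists Coo roo : R, forall x : 'rV[R]_n.+1,
     `|r x - roo%:E| <= (Coo / ln (expR 1 + enorm x))%:E).

Definition modular (r : 'rV[R]_n.+1 -> R) (f : 'rV[R]_n.+1 -> R) : \bar R :=
  \int[leb]_x (`|f x| `^ r x)%:E.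

Definition lux_norm (r : 'rV[R]_n.+1 -> R) (f : 'rV[R]_n.+1 -> R) : \bar R :=
  ereal_inf [set l%:E | l in
    [set l : R | (0 < l)%R /\ modular r (fun x => f x / l)%R <= 1]].

Definition Lvar (r : 'rV[R]_n.+1 -> R) : set ('rV[R]_n.+1 -> R) :=
  [set f : 'rV[R]_n.+1 -> R | measurable_fun [set: leb_space R n] f /\
    exists2 l : R, (0 < l)%R & modular r (fun x => f x / l)%R < +oo].

Definition spow (q : 'rV[R]_n.+1 -> R) (f : 'rV[R]_n.+1 -> R)
    : 'rV[R]_n.+1 -> R :=
  fun x => (f x * `|f x| `^ (q x - 1))%R.

(* fine is harmless: log_holder (quot_exp p q) with 1 < ess_inf makes quot_exp
   p q continuous with values in ]1, +oo[, so p and q are finite everywhere. *)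
Definition normV (p q : 'rV[R]_n.+1 -> \bar R) (g : nat -> 'rV[R]_n.+1 -> R)
    : \bar R :=
  \sum_(0 <= nu <oo) lux_norm (fine \o quot_exp p q) (g nu).

Definition spaceV (p q : 'rV[R]_n.+1 -> \bar R)
    : set (nat -> 'rV[R]_n.+1 -> R) :=
  [set g | exists2 f : nat -> 'rV[R]_n.+1 -> R,
     (forall nu, Lvar (fine \o p) (f nu)) /\
     (forall nu, g nu = spow (fine \o q) (f nu)) &
     normV p q g < +oo].

End variable_exponents.

Section approximation_identities.
Context {R : realType} {n : nat}.
Local Open Scope ereal_scope.

Definition dilate (phi : 'rV[R]_n.+1 -> R) (t : R) : 'rV[R]_n.+1 -> R :=
  fun x => (t ^- n.+1 * phi (t^-1 *: x))%R.

Definition approx_identity (phi : 'rV[R]_n.+1 -> R) : Prop :=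
  leb.-integrable [set: leb_space R n] (EFin \o phi) /\
  \int[leb]_x (phi x)%:E = 1.

Definition radial_majorant (phi : 'rV[R]_n.+1 -> R) : 'rV[R]_n.+1 -> \bar R :=
  fun x => ereal_sup
    [set (`|phi y|)%:E | y in [set y | (enorm x < enorm y)%R]].

Definition potential_type (phi : 'rV[R]_n.+1 -> R) : Prop :=
  approx_identity phi /\
  leb.-integrable [set: leb_space R n] (radial_majorant phi).

(* Extended-real valued: it is finite at x only if the integrand is integrable,
   so a limit statement about convol includes that the convolution exists. *)
Definition convol (phi h : 'rV[R]_n.+1 -> R) : 'rV[R]_n.+1 -> \bar R :=
  fun x => \int[leb]_y (phi (x - y) * h y)%:E.

Definition l2norm (a : nat -> \bar R) : \bar R :=
  (\sum_(0 <= nu <oo) `|a nu| ^+ 2) `^ 2^-1.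

End approximation_identities.

(* Main.v *)
Require Import Defs.
From HB Require Import structures.
From mathcomp Require Import all_boot all_order all_algebra.
From mathcomp Require Import all_classical all_reals all_analysis.
From mathcomp Require Import measurable_realfun ess_sup_inf.
From mathcomp Require Import ring lra.
Import Order.TTheory GRing.Theory Num.Theory.
Import numFieldNormedType.Exports.
Local Open Scope classical_set_scope.
Local Open Scope ring_scope.
Local Open Scope ereal_scope.
Set Implicit Arguments.
Unset Strict Implicit.
Unset Printing Implicit Defensive.

(** Almost every point x is a Lebesgue point of g, seen as one function with
    values in l^1: writing D_x y for the sum over nu of |g_nu y - g_nu x|, the
    mean of D_x over the cube of radius r around x tends to 0 with r. Since the
    integral of phi_t is 1, the l^2 norm of (phi_t * g)(x) - g(x) is at most its
    l^1 norm, hence at most the integral over y of |phi_t (x - y)| D_x y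
    [l2norm_convol_le]. It remains to see that this integral tends to 0
    [kernel_limit].

    For that, cut R^(n+1) into the dyadic shells 2^k <= |z| < 2^(k+1), for k in Z.
    On the k-th shell |phi| is at most b_k, the supremum of |phi| outside the
    Euclidean ball of radius 2^k. On a shell smaller by a dimensional factor the
    radial majorant is at least b_k, and the measure of a shell is proportional
    to the power n+1 of its radius; as these smaller shells are disjoint,
    integrability of the majorant makes the series of the b_k 2^(k(n+1))
    converge [potential_shell_bound]. The integral is then at most a constant times the
    series of the b_k 2^(k(n+1)) A(2^(k+1) t), where A(r) is the mean of D_x over
    the cube of radius r. A tends to 0 at 0 and is bounded, so the series tends
    to 0 with t.

    The mean A is bounded at large radii because the sum G of the |g_nu| is
    dominated by a constant plus an integrable function [lux_norm_dominated].
    Indeed choose l_nu slightly larger than the Luxemburg norm of g_nu, with a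
    finite sum, and put u = |g_nu| / l_nu. As r = p/q is at least 1 almost
    everywhere, u <= 1 + u^r, and u^r has integral at most 1; multiply by l_nu
    and add up.

    Lebesgue points come from a single density statement: if f >= 0 is integrable
    and vanishes on E, then its means on small cubes tend to 0 at almost every
    point of E [zero_density]. Indeed f has a small integral over a suitable open
    neighbourhood U of E, and by Vitali's covering lemma the points of E where
    the means of f stay above e are covered by the enlargements of disjoint cubes
    inside U on which f has mean at least a multiple of e; their total volume is
    at most a constant times the integral of f over U, divided by e
    [vitali_weak_type]. Apply this to the positive part of the l^1 distance from
    g to c, minus e, where c runs through a countable dense subset of l^1
    [lebesgue_points].

    Cubes are balls of the maximum norm of row vectors. Covering by one box shows
    that their measure is at most (2r)^(n+1), and it is multiplied by |s|^(n+1)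
    under an affine map of ratio s [leb_affine]. The measure of a cube is
    therefore positive unless the whole measure vanishes, and in that case every
    property holds almost everywhere. *)

(** * Vitali's covering lemma for finitely many balls *)

(** Greedy selection by decreasing radius: an unselected ball meets a selected
    ball that is at least as large, hence lies in its threefold enlargement. *)
Lemma finite_vitali (R : realType) (V : normedModType R) (s : seq (V * R)) :
  (forall c, c \in s -> (0 < c.2)%R) -> exists D : seq (V * R),
  [/\ uniq D, {subset D <= s},
      trivIset [set` D] (fun c => ball c.1 c.2) &
      forall c, c \in s -> exists2 d, d \in D &
        ball c.1 c.2 `<=` ball d.1 (3 * d.2)%R].
Proof.
pose ge2 (c d : V * R) := (d.2 <= c.2)%R.
have ge2_trans : transitive ge2 by move=> x y z xy /le_trans; exact.
wlog : s / sorted ge2 s.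
  move=> h s0; have [|c|D [uD Ds tD sD]] := h (sort ge2 s).
  - by apply: sort_sorted => c d; exact: le_total.
  - by rewrite mem_sort; exact: s0.
  exists D; split => // [c /Ds|c cs]; first by rewrite mem_sort.
  by apply: sD; rewrite mem_sort.
have [k] := ubnP (size s); elim: k s => // k IH [|h t] /=.
  by move=> _ _ _; exists [::]; split => //; move=> ? ? [].
rewrite ltnS => tk ht s0.
pose t' := [seq c <- t | `[< ball h.1 h.2 `&` ball c.1 c.2 = set0 >]].
have /(order_path_min ge2_trans)/allP hmax := ht.
have h0 : (0 < h.2)%R by apply: s0; rewrite mem_head.
have [||c|D [uD Dt tD sD]] := IH t'.
- by rewrite (leq_ltn_trans _ tk)// size_filter count_size.
- by apply: sorted_filter => //; exact: path_sorted ht.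
- by rewrite mem_filter => /andP[_ ct]; apply: s0; rewrite inE ct orbT.
have hD c : c \in D -> ball h.1 h.2 `&` ball c.1 c.2 = set0.
  by move=> /Dt; rewrite mem_filter => /andP[/asboolP].
exists (h :: D); split.
- rewrite /= uD andbT; apply/negP => /hD; rewrite setIid => /seteqP[+ _].
  by move/(_ h.1); apply; exact: ballxx.
- move=> c; rewrite !inE => /orP[->//|/Dt].
  by rewrite mem_filter => /andP[_ ->]; rewrite orbT.
- apply/trivIsetP => c d /=; rewrite !inE.
  move=> /orP[/eqP->|cD] /orP[/eqP->|dD]; first by rewrite eqxx.
  + by move=> _; exact: hD.
  + by move=> _; rewrite setIC; exact: hD.
  + by move=> cd; move/trivIsetP : tD; apply.
move=> c; rewrite inE => /orP[/eqP->|ct].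
  by exists h; rewrite ?mem_head//; apply: le_ball; rewrite ler_peMl ?ler1n// ltW.
have [hc|/set0P[z [hz cz]]] := eqVneq (ball h.1 h.2 `&` ball c.1 c.2) set0.
  have [|d dD cd] := sD c; first by rewrite mem_filter ct andbT; exact/asboolP.
  by exists d => //; rewrite inE dD orbT.
exists h; first exact: mem_head.
have ch : (c.2 <= h.2)%R by exact: hmax.
move=> y cy; have -> : (3 * h.2 = h.2 + (h.2 + h.2))%R by ring.
apply: ball_triangle hz _; apply: (@le_ball _ _ _ (c.2 + c.2)%R); first lra.
exact: ball_triangle (ball_sym cz) cy.
Qed.

(** * Series of nonnegative terms and functions with values in l^1 *)

Lemma nneseries_small_tail (R : realType) (u : nat -> \bar R) (e : R) :
  (forall k, 0 <= u k) -> \sum_(0 <= k <oo) u k < +oo -> (0 < e)%R ->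
  exists N, \sum_(N <= k <oo) u k < e%:E.
Proof.
move=> u0 uoo e0.
have /fine_cvgP[tfin /cvgrPdist_lt/(_ _ e0) tlt] :=
  nneseries_tail_cvg uoo (fun k _ => u0 k).
have [N _ /(_ N (leqnn N))[Nfin]] : \forall N \near \oo,
    \sum_(N <= k <oo) u k \is a fin_num /\
    (`|0 - fine (\sum_(N <= k <oo) u k)| < e)%R.
  by near=> N; split; near: N.
rewrite sub0r normrN => lt_e; exists N.
rewrite -(fineK Nfin) lte_fin; apply: le_lt_trans lt_e; exact: ler_norm.
Unshelve. all: by end_near. Qed.

Lemma nneseries_ge_term (R : realType) (u : nat -> \bar R) (k : nat) :
  (forall k, 0 <= u k) -> u k <= \sum_(0 <= k <oo) u k.
Proof.
move=> u0; rewrite (@nneseries_split _ _ 0 k.+1)// add0n big_nat_recr//=.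
apply: le_trans (leeDl _ _); last exact: nneseries_ge0.
by rewrite leeDr// sume_ge0.
Qed.

(** The finitely supported rational sequences form the countable dense subset
    of l^1 through which the almost everywhere statements are quantified. *)
Lemma l1_rat_dense (R : realType) (a : nat -> R) (e : R) : (0 < e)%R ->
  \sum_(0 <= k <oo) `|a k|%:E < +oo -> exists c : seq rat,
    \sum_(0 <= k <oo) `|a k - ratr c`_k|%:E < e%:E.
Proof.
move=> e0 aoo; have e2 : (0 < e / 2)%R by rewrite divr_gt0.
have [|N tailN] := nneseries_small_tail _ aoo e2.
  by move=> k; rewrite lee_fin.
have eN : (0 < e / 2 / N.+1%:R)%R by rewrite divr_gt0.
have /choice[q qa] (k : nat) : exists q : rat,
    (`|a k - ratr q| <= e / 2 / N.+1%:R)%R.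
  have [|q] := @rat_in_itvoo R (a k - e / 2 / N.+1%:R)%R (a k + e / 2 / N.+1%:R)%R.
    by rewrite ltrD2l gtrN.
  rewrite in_itv/= => /andP[h1 h2]; exists q; apply: ltW.
  by rewrite distrC ltr_distl h1 h2.
exists (mkseq q N).
rewrite (@nneseries_split _ _ 0 N) ?add0n; last by move=> k _; rewrite lee_fin.
have -> : e%:E = (e / 2)%:E + (e / 2)%:E by rewrite -EFinD -splitr.
apply: lee_ltD; last 1 first.
  rewrite [ltLHS](_ : _ = \sum_(N <= k <oo) `|a k|%:E)//.
  congr (limn _); apply/funext => M; apply: eq_big_nat => k /andP[Nk _].
  by rewrite nth_default ?rmorph0 ?subr0// size_mkseq.
  by rewrite sumEFin.
rewrite sumEFin lee_fin; apply: (@le_trans _ _ (\sum_(0 <= k < N) e / 2 /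
    N.+1%:R)%R).
  rewrite big_nat [leRHS]big_nat; apply: ler_sum => k /andP[_ kN].
  by rewrite nth_mkseq.
rewrite sumr_const_nat subn0 -[leLHS]mulr_natr -mulrA ler_piMr ?(ltW e2)//.
by rewrite mulrC ler_pdivrMr ?mul1r ?ler_nat.
Qed.

Lemma measurable_normr_EFin d (T : measurableType d) (R : realType) (f : T -> R) :
  measurable_fun [set: T] f -> measurable_fun [set: T] (fun y => `|f y|%:E).
Proof. by move=> mf; apply/measurable_EFinP; exact: measurableT_comp. Qed.

Section l1_distance.
Context (T : Type) (R : realType).
Variable g : nat -> T -> R.

Definition l1_dist (c : nat -> R) (y : T) := \sum_(0 <= k <oo) `|g k y - c k|%:E.

Definition l1_excess (c : nat -> R) (e : R) (y : T) :=
  maxe (l1_dist c y - e%:E) 0.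

Lemma l1_dist_ge0 c y : 0 <= l1_dist c y.
Proof. by apply: nneseries_ge0 => k _ _; rewrite lee_fin. Qed.

Lemma l1_dist0 y : l1_dist (fun=> 0%R) y = \sum_(0 <= k <oo) `|g k y|%:E.
Proof. by apply: eq_eseriesr => k _; rewrite subr0. Qed.

Lemma l1_dist_triangle c c' y :
  l1_dist c y <= l1_dist c' y + \sum_(0 <= k <oo) `|c' k - c k|%:E.
Proof.
rewrite -nneseriesD; try by move=> k _ _; rewrite lee_fin.
apply: lee_nneseries => k _; first by move=> _; rewrite lee_fin.
by rewrite -EFinD lee_fin; exact: ler_distD.
Qed.

Lemma l1_excess_ge0 c e y : 0 <= l1_excess c e y.
Proof. by rewrite /l1_excess le_max lexx orbT. Qed.

Lemma l1_dist_le_excess c e y : l1_dist c y <= l1_excess c e y + e%:E.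
Proof. by rewrite -leeBlDr// /l1_excess le_max lexx. Qed.

End l1_distance.

Section l1_valued_functions.
Context d (T : measurableType d) (R : realType) (mu : {measure set T -> \bar R}).
Variable g : nat -> T -> R.
Hypothesis mg : forall k, measurable_fun [set: T] (g k).

Lemma measurable_l1_dist c : measurable_fun [set: T] (l1_dist g c).
Proof.
apply: ge0_emeasurable_sum => [k y _ _|k _]; first by rewrite lee_fin.
apply/measurable_EFinP; apply: measurableT_comp => //.
by apply: measurable_funB.
Qed.


Lemma measurable_l1_excess c e : measurable_fun [set: T] (l1_excess g c e).
Proof.
apply: measurable_maxe => //.
by apply: emeasurable_funB => //; exact: measurable_l1_dist.
Qed.


Lemma integral_l1_excess_fin c e (B : set T) : (0 <= e)%R ->
  measurable B -> mu B < +oo -> \sum_(0 <= k <oo) `|c k|%:E < +oo ->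
  \int[mu]_(y in B) l1_dist g (fun=> 0%R) y < +oo ->
  \int[mu]_(y in B) l1_excess g c e y < +oo.
Proof.
move=> e0 mB Boo coo goo; set C := \sum_(_ <= k <oo) _ in coo.
have C0 : 0 <= C by apply: nneseries_ge0 => k _ _; rewrite lee_fin.
have Cfin : C \is a fin_num by rewrite ge0_fin_numE.
have md : measurable_fun B (l1_dist g (fun=> 0%R)).
  by apply: measurable_funTS; exact: measurable_l1_dist.
apply: (@le_lt_trans _ _ (\int[mu]_(y in B) (l1_dist g (fun=> 0%R) y + (fine
    C)%:E))).
  apply: ge0_le_integral => //.
  - by move=> y _; exact: l1_excess_ge0.
  - by apply: measurable_funTS; exact: measurable_l1_excess.
  - exact: emeasurable_funD.
  - move=> y _; rewrite /l1_excess ge_max adde_ge0 ?lee_fin ?fine_ge0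
      ?l1_dist_ge0// andbT.
    apply: (@le_trans _ _ (l1_dist g c y)).
      by rewrite leeBlDr// leeDl// lee_fin.
    apply: le_trans (l1_dist_triangle _ _ (fun=> 0%R) y) _.
    rewrite fineK// leeD2l//; apply: lee_nneseries => k _;
        last by rewrite sub0r normrN.
    by move=> _; rewrite lee_fin.
rewrite ge0_integralD//; last 2 first.
- by move=> y _; exact: l1_dist_ge0.
- by move=> y _; rewrite lee_fin fine_ge0.
rewrite integral_cst// lte_add_pinfty//.
by rewrite lte_mul_pinfty ?lee_fin ?fine_ge0.
Qed.


End l1_valued_functions.

Lemma l1_rat_fin (R : realType) (c : seq rat) : \sum_(0 <= k <oo) `|ratr c`_k
    : R|%:E < +oo.
Proof.
rewrite (@nneseries_split _ _ 0 (size c)); last by move=> k _; rewrite lee_fin.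
rewrite eseries0 ?adde0 ?add0n.
  by rewrite sumEFin ltry.
by move=> k ck _; rewrite nth_default ?rmorph0 ?normr0.
Qed.

(** * Dyadic scales *)

(** A bijection between nat and Z, so that families indexed by all dyadic
    scales can be summed as ordinary series. *)
Definition zcode (k : nat) : int := if odd k then Negz k./2 else Posz k./2.

Lemma zcode_inj : injective zcode.
Proof.
move=> i j; rewrite /zcode.
have := odd_double_half i; have := odd_double_half j.
by case: (odd i); case: (odd j) => //= hj hi [h]; rewrite -hi -hj h.
Qed.

Definition dyadic (R : realType) (k : nat) : R := (2 ^ zcode k)%R.

Lemma dyadic_gt0 (R : realType) k : (0 < dyadic R k)%R.
Proof. exact: exprz_gt0. Qed.

(** Distinct powers of 2 differ at least by a factor 2, so the shells at
    distinct scales are disjoint. *)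
Lemma dyadic_sep (R : realType) i j : i != j ->
  (2 * dyadic R i <= dyadic R j)%R \/ (2 * dyadic R j <= dyadic R i)%R.
Proof.
wlog : i j / (zcode i < zcode j)%R.
  move=> h ij; have [lt_ij|lt_ji|/zcode_inj ij'] := ltgtP (zcode i) (zcode j).
  - exact: h.
  - by apply/or_comm; apply: h => //; rewrite eq_sym.
  - by rewrite ij' eqxx in ij.
move=> ij _; left; rewrite /dyadic -[X in (X * _)%R]expr1z -expfzDr//.
by rewrite ler_weXz2l ?ler1n// lez1D.
Qed.

Lemma dyadic_exists (R : realType) (r : R) : (0 < r)%R ->
  exists k, (dyadic R k <= r < 2 * dyadic R k)%R.
Proof.
move=> r0; have [r1|r1] := leP 1%R r.
  pose m := trunc_log 2 (Num.truncn r).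
  have tr0 : (0 < Num.truncn r)%N by rewrite truncn_gt0.
  have /andP[m1 m2] := trunc_log_bounds (isT : (1 < 2)%N) tr0.
  exists m.*2; rewrite /dyadic /zcode odd_double doubleK.
  have /andP[t1 t2] := truncn_itv (ltW r0).
  rewrite -exprnP -exprS; apply/andP; split.
    by apply: le_trans t1; rewrite -natrX ler_nat.
  by apply: lt_le_trans t2 _; rewrite -natrX ler_nat.
have ex : exists m, ((2 ^+ m.+1)^-1 <= r)%R.
  exists (Num.truncn r^-1); rewrite -[leRHS]invrK lef_pV2 ?posrE ?exprn_gt0
      ?invr_gt0//.
  apply: le_trans (ltW (truncnS_gt _)) _; rewrite -natrX ler_nat.
  exact: ltnW (ltn_expl _ _).
pose m := ex_minn ex; exists m.*2.+1.
rewrite /dyadic /zcode /= odd_double /= uphalf_double.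
rewrite /m; case: ex_minnP => {m} m mr mmin.
rewrite NegzE -exprnN mr/=; case: m mmin {mr} => [_|m mmin].
  by rewrite expr1 mulfV.
rewrite ltNge; apply/negP => h; suff : (m.+1 <= m)%N by rewrite ltnn.
apply: mmin; apply: le_trans h.
by rewrite [in leRHS]exprS invfM mulrA mulfV// mul1r.
Qed.

(** * Modulars and the l^2 norm *)

Lemma measurable_fun_powRR d (T : measurableType d) (R : realType) (f r : T -> R) :
  measurable_fun [set: T] f -> measurable_fun [set: T] r ->
  measurable_fun [set: T] (fun x => f x `^ r x)%R.
Proof.
move=> mf mr; rewrite (_ : (fun x => _) = fun x => if f x == 0%R then
    (if r x == 0%R then 1%R else 0%R) else expR (r x * ln (f x))); last first.
  by apply/funext => x; rewrite /powR; case: ifP => // _; case: ifP.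
apply: measurable_fun_ifT; first exact: measurable_fun_eqr.
  by apply: measurable_fun_ifT => //; exact: measurable_fun_eqr.
apply: measurableT_comp => //; apply: measurable_funM => //.
exact: measurableT_comp.
Qed.

(** With u = |f| / l, the bound u <= 1 + u^r, valid as soon as r >= 1, trades
    the modular for an integral: f is the sum of a function bounded by l and of
    one whose integral is at most l. *)
Lemma integral_le_modular d (T : measurableType d) (R : realType)
    (mu : {measure set T -> \bar R}) (f r : T -> R) (l : R) (B : set T) :
  measurable_fun [set: T] f -> measurable_fun [set: T] r -> (0 < l)%R ->
  {ae mu, forall x, (1 <= r x)%R} ->
  \int[mu]_x (`|f x / l| `^ r x)%:E <= 1 -> measurable B ->
  \int[mu]_(x in B) `|f x|%:E <= l%:E * mu B + l%:E.
Proof.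
move=> mf mr l0 r1 mod1 mB.
pose v x := (`|f x / l| `^ r x)%R.
have mv : measurable_fun [set: T] (EFin \o v).
  apply/measurable_EFinP; apply: measurable_fun_powRR => //.
  by apply: measurableT_comp => //; exact: measurable_funM.
have mvB : measurable_fun B (EFin \o v) by exact: measurable_funTS.
have v0 x : 0 <= (v x)%:E by rewrite lee_fin powR_ge0.
apply: (@le_trans _ _ (\int[mu]_(x in B) (l%:E + l%:E * (v x)%:E))).
  apply: ae_ge0_le_integral => //.
  - by apply: measurable_funTS; exact: measurable_normr_EFin.
  - by move=> x _; rewrite adde_ge0// ?mule_ge0// lee_fin ltW.
  - by apply: emeasurable_funD => //; exact: measurable_funeM.
  - apply: filterS r1 => x r1 _; rewrite -EFinM -EFinD lee_fin.
    have -> : `|f x|%R = (l * `|f x / l|)%R.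
      by rewrite normrM normfV (gtr0_norm l0) mulrCA mulfV ?mulr1// gt_eqF.
    rewrite -[X in (X + _)%R]mulr1 -mulrDr ler_pM2l//.
    have [u1|u1] := leP `|f x / l|%R 1%R.
      by apply: le_trans u1 _; rewrite lerDl powR_ge0.
    apply: (@le_trans _ _ (v x)); last by rewrite lerDr.
    by rewrite -[leLHS]powRr1// ler_powR// ltW.
rewrite ge0_integralD//; last 3 first.
- by move=> x _; rewrite lee_fin ltW.
- by move=> x _; rewrite mule_ge0// lee_fin ltW.
- exact: measurable_funeM.
rewrite integral_cst// leeD2l// ge0_integralZl_EFin ?(ltW l0)//.
rewrite -[leRHS]mule1; apply: lee_wpmul2l; first by rewrite lee_fin ltW.
apply: le_trans mod1; exact: ge0_subset_integral.
Qed.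

Lemma l2norm_ge0 (R : realType) (a : nat -> \bar R) : 0 <= l2norm a.
Proof. exact: poweR_ge0. Qed.

(** Each term is at most the sum S, so the sum of the squares is at most S^2. *)
Lemma l2norm_le_l1 (R : realType) (a : nat -> \bar R) :
  l2norm a <= \sum_(0 <= k <oo) `|a k|.
Proof.
set S := \sum_(_ <= k <oo) _.
have a0 k : 0 <= `|a k| by exact: abse_ge0.
have S0 : 0 <= S by exact: nneseries_ge0.
have [->|Soo] := eqVneq S +oo; first exact: leey.
have Sfin : S \is a fin_num by rewrite ge0_fin_numE// ltey.
have s0 : (0 <= fine S)%R by exact: fine_ge0.
have sq_le : \sum_(0 <= k <oo) `|a k| ^+ 2 <= ((fine S) ^+ 2)%:E.
  apply: (@le_trans _ _ (\sum_(0 <= k <oo) (fine S)%:E * `|a k|)).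
    apply: lee_nneseries => k _; first by move=> _; exact: expe_ge0.
    rewrite expe2; apply: lee_wpmul2r => //.
    by rewrite fineK//; exact: (nneseries_ge_term k a0).
  by rewrite nneseriesZl// -/S -{2}(fineK Sfin) -EFinM expr2.
apply: (@le_trans _ _ (((fine S) ^+ 2)%:E `^ 2^-1)).
  apply: gt0_ler_poweR => //.
  - by rewrite in_itv/= leey andbT nneseries_ge0// => k _ _; exact: expe_ge0.
  - by rewrite in_itv/= leey andbT lee_fin sqr_ge0.
by rewrite poweR_EFin powR12_sqrt ?sqr_ge0// sqrtr_sqr ger0_norm// fineK.
Qed.

Lemma cvg_at_right0_ge0 (R : realType) (f : R -> \bar R) :
  (forall t, 0 <= f t) ->
  (forall e : R, (0 < e)%R -> exists2 d : R, (0 < d)%R &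
    forall t : R, (0 < t)%R -> (t < d)%R -> f t <= e%:E) ->
  f t @[t --> (0 : R)%R^'+] --> 0.
Proof.
move=> f0 fe; apply/fine_cvgP; split.
  have [d d0 fd] := fe 1%R ltr01.
  near=> t; rewrite ge0_fin_numE//; apply: le_lt_trans (ltry 1%R); apply: fd.
    by near: t; exact: nbhs_right_gt.
  by near: t; exact: nbhs_right_lt.
apply/cvgrPdist_le => e e0; have [d d0 fd] := fe e e0.
near=> t; have ft : f t <= e%:E.
  apply: fd; first by near: t; exact: nbhs_right_gt.
  by near: t; exact: nbhs_right_lt.
have ffin : f t \is a fin_num by rewrite ge0_fin_numE//;
    exact: le_lt_trans ft (ltry _).
by rewrite sub0r normrN ger0_norm ?fine_ge0// -lee_fin fineK.
Unshelve. all: by end_near. Qed.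

(** * Boxes and cubes for the Lebesgue measure *)

Section lebesgue_space.
Context {R : realType} {n : nat}.
Implicit Types (x y a : 'rV[R]_n.+1) (A : set 'rV[R]_n.+1).

Notation leb := (@leb R n).
Notation space := (leb_space R n).
Notation box := ('rV[R]_n.+1 * 'rV[R]_n.+1)%type.

(** A hyperplane orthogonal to an axis cuts a half-open box into two half-open
    boxes, and volumes add up; this is what makes half-spaces measurable. *)
Lemma obox_cut (i : 'I_n.+1) (b : R) (c : box) : exists c1 c2,
  [/\ obox c `&` [set x | (x 0 i <= b)%R] `<=` obox c1,
      obox c `&` ~` [set x | (x 0 i <= b)%R] `<=` obox c2 &
      (obox_vol c = obox_vol c1 + obox_vol c2)%R].
Proof.
exists (c.1, \row_j if j == i then Num.min (c.2 0 j) b else c.2 0 j)%R.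
exists ((\row_j if j == i then Num.max (c.1 0 j) b else c.1 0 j)%R, c.2).
split=> [x [cx xb] j|x [cx /negP]|].
- rewrite /= mxE; case: eqP => [->|_]; last exact: cx.
  by have /andP[-> cxi] := cx i; rewrite le_min cxi.
- rewrite -ltNge => bx j; rewrite /= mxE; case: eqP => [->|_]; last exact: cx.
  by have /andP[h ->] := cx i; rewrite gt_max h bx.
rewrite /obox_vol (bigD1 i)//= [in X in (_ = X + _)%R](bigD1 i)//=.
rewrite [in X in (_ = _ + X)%R](bigD1 i)//= !mxE eqxx.
under [X in (_ = _ * X + _)%R]eq_bigr => j ji do rewrite mxE (negbTE ji).
under [X in (_ = _ + _ * X)%R]eq_bigr => j ji do rewrite mxE (negbTE ji).
rewrite -mulrDl; congr (_ * _)%R.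
by rewrite !maxEle !minEle; do ![case: ifPn; rewrite -?ltNge] => *; lra.
Qed.

Lemma measurable_halfspace (i : 'I_n.+1) (b : R) :
  measurable ([set x | (x 0 i <= b)%R] : set space).
Proof.
set H := [set x | _].
apply: (@le_caratheodory_measurable _ _ (leb_outer_measure R n)) => X.
apply: le_ereal_inf_tmp => _ [c Xc <-].
have [d1 /choice[d2 dE]] := choice (fun k => obox_cut i b (c k)).
rewrite (eq_eseriesr (g := fun k => (obox_vol (d1 k))%:E + (obox_vol (d2
    k))%:E)); last first.
  by move=> k _; have [_ _ ->] := dE k.
rewrite nneseriesD; try by move=> *; exact: obox_vol_ge0.
apply: leeD; apply: ereal_inf_lbound.
- exists d1 => // x [/Xc[k _ ck] Hx]; exists k => //.
  by have [+ _ _] := dE k; apply.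
- exists d2 => // x [/Xc[k _ ck] Hx]; exists k => //.
  by have [_ + _] := dE k; apply.
Qed.

Lemma measurable_fun_coord (i : 'I_n.+1) :
  measurable_fun [set: space] (fun x : 'rV[R]_n.+1 => (x 0 i)%R).
Proof.
apply: (measurability _ (RGenOInfty.measurableE R)) => _ [_ [b ->] <-].
rewrite setTI (_ : (fun x : 'rV[R]_n.+1 => (x 0 i)%R) @^-1` `]b,
    +oo[ = ~` [set x | (x 0 i <= b)%R]).
  by apply: measurableC; exact: measurable_halfspace.
by apply/seteqP; split => x /=; rewrite in_itv/= andbT ltNge => /negP.
Qed.

Definition open_box (c : box) : set 'rV[R]_n.+1 :=
  [set x | forall i, (c.1 0 i < x 0 i < c.2 0 i)%R].

Lemma measurable_open_box (c : box) : measurable (open_box (c : box) : set space).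
Proof.
rewrite (_ : open_box c = \bigcap_(i in [set: 'I_n.+1])
   ((fun x : 'rV[R]_n.+1 => (x 0 i)%R) @^-1` `](c.1 0 i)%R, (c.2 0 i)%R[%classic)).
  apply: fin_bigcap_measurable => // i _; rewrite -[X in measurable X]setTI.
  exact: (measurable_fun_coord i).
apply/seteqP; split => x.
  by move=> h i _ /=; rewrite in_itv/= h.
by move=> h i; have := h i I; rewrite /= in_itv.
Qed.

Lemma open_open_box (c : box) : open (open_box c).
Proof.
rewrite openE => y cy.
have Fy : Filter (nbhs y) by exact: nbhs_filter.
refine (@filter_forall _ _ (fun i => [set z : 'rV[R]_n.+1 | (c.1 0 i < z 0 i <
    c.2 0 i)%R]) (nbhs y) _ _) => i.
have : nbhs ((y 0 i)%R : R) `](c.1 0 i)%R, (c.2 0 i)%R[%classic.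
  by apply: open_nbhs_nbhs; split; [exact: itv_open|rewrite /= in_itv; exact: cy].
move=> /(@coord_continuous _ _ _ 0%R i y); refine (@filterS _ _ Fy _ _ _) => z.
by rewrite /= in_itv.
Qed.

Lemma open_box_sub (c : box) : open_box c `<=` obox c.
Proof. by move=> x h i; have /andP[-> /ltW ->] := h i. Qed.

Lemma ball_coordP x (r : R) y : (0 < r)%R ->
  ball x r y <-> forall i, (`|x 0 i - y 0 i| < r)%R.
Proof.
move=> r0; split => [[_ h] i|h]; first exact: h.
by split => // i j; rewrite ord1; exact: h.
Qed.

Lemma ball_le0 x (r : R) : (r <= 0)%R -> ball x r = set0.
Proof. by move=> r0; rewrite -subset0 => y []; rewrite ltNge r0. Qed.

Lemma ball_open_box x (r : R) :
  ball x r = open_box (x - const_mx r, x + const_mx r)%R.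
Proof.
have [r0|r0] := ltP 0%R r; last first.
  rewrite ball_le0//; apply/esym/seteqP; split => // y /(_ ord0).
  by rewrite /= !mxE => /andP[h1 h2]; lra.
apply/seteqP; split => y.
  move/(ball_coordP _ _ r0) => h i; have := h i.
  by rewrite ltr_norml /= !mxE => /andP[h1 h2]; apply/andP; split; lra.
move=> h; apply/(ball_coordP _ _ r0) => i; have := h i.
by rewrite ltr_norml /= !mxE => /andP[h1 h2]; apply/andP; split; lra.
Qed.

Lemma measurable_ball_space x (r : R) : measurable (ball x r : set space).
Proof. by rewrite ball_open_box; exact: measurable_open_box. Qed.

Lemma leb_obox_le (c : box) : leb_outer (obox c) <= (obox_vol c)%:E.
Proof.
have vol0 : obox_vol (0 : 'rV[R]_n.+1, 0)%R = 0%R.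
  by rewrite /obox_vol big_ord_recl /= !mxE subrr maxxx mul0r.
apply: ereal_inf_lbound; exists (fun k : nat => if k == 0%N then c else (0, 0)%R).
  by move=> x cx; exists 0%N.
rewrite (@nneseries_split _ _ 0 1) ?add0n => [|k _]; last exact: obox_vol_ge0.
rewrite big_nat1 eseries0 ?adde0// => -[//|k _ _] /=; rewrite vol0 //.
Qed.

Lemma leb_ball_le x (r : R) : (0 < r)%R ->
  leb (ball x r) <= ((2 * r) ^+ n.+1)%:E.
Proof.
move=> r0; rewrite ball_open_box.
apply: le_trans (le_leb_outer (@open_box_sub _)) _.
apply: le_trans (leb_obox_le _) _; rewrite lee_fin /obox_vol.
rewrite (eq_bigr (fun=> 2 * r)%R) ?prodr_const ?card_ord// => i _.
by rewrite /= !mxE max_r; lra.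
Qed.

Lemma leb_ball_fin x (r : R) : leb (ball x r) < +oo.
Proof.
have [r0|r0] := ltP 0%R r; last by rewrite ball_le0// measure0.
exact: le_lt_trans (leb_ball_le x r0) (ltry _).
Qed.

(** * Affine maps and outer regularity *)

(** The factor d > 1 leaves room to enclose the image, which is half-open on
    the other side when s < 0, in an open box. With s = 1 the same enclosure
    turns covers by boxes into open sets. *)
Lemma obox_affine_open_box (a : 'rV[R]_n.+1) (s d : R) (c : box) :
  s != 0%R -> (1 < d)%R -> exists c',
    (fun x => a + s *: x)%R @` obox c `<=` open_box c' /\
    (obox_vol c' = (d * `|s|) ^+ n.+1 * obox_vol c)%R.
Proof.
move=> s0 d1.
have [h|/existsNP[i /negP]] := pselect (forall i, (c.1 0 i < c.2 0 i)%R);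
    last first.
  rewrite -leNgt => ci; exists (0, 0)%R; split.
    by move=> _ [x cx <-]; have := cx i; move=> /andP[h1 h2]; exfalso; lra.
  rewrite [RHS]mulrC /obox_vol (bigD1 i)//= !mxE subrr maxxx mul0r.
  by rewrite (bigD1 i)//= max_l ?mul0r// subr_le0.
pose m i := ((c.1 0 i + c.2 0 i) / 2)%R.
pose w i := (d * `|s| * ((c.2 0 i - c.1 0 i) / 2))%R.
exists (\row_i (a 0 i + s * m i - w i), \row_i (a 0 i + s * m i + w i))%R.
have s1 : (0 < `|s|)%R by rewrite normr_gt0.
split=> [_ [x cx <-] i|]; last first.
  have -> : ((d * `|s|) ^+ n.+1 = \prod_(i < n.+1) (d * `|s|))%R.
    by rewrite prodr_const card_ord.
  rewrite /obox_vol -big_split/=.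
  apply: eq_bigr => i _; rewrite !mxE [in RHS]max_r; last first.
    by rewrite subr_ge0 ltW.
  have -> : (a 0 i + s * m i + w i - (a 0 i + s * m i - w i) = 2 * w i)%R by ring.
  have -> : (2 * w i = d * `|s| * (c.2 0 i - c.1 0 i))%R by rewrite /w; field.
  by rewrite max_r// !mulr_ge0// ?subr_ge0 1?ltW//; lra.
rewrite /= !mxE; have /andP[h1 h2] := cx i.
have : (`|s * (x 0 i - m i)| < w i)%R.
  rewrite normrM /w (mulrC d) -mulrA ltr_pM2l//.
  apply: (@le_lt_trans _ _ ((c.2 0 i - c.1 0 i) / 2)%R).
    by rewrite ler_norml /m; apply/andP; split; lra.
  by have := h i => hi; rewrite ltr_pMl//; lra.
by rewrite ltr_norml mulrBr => /andP[h3 h4]; apply/andP; split; lra.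
Qed.

Lemma cover_affine_open_box (a : 'rV[R]_n.+1) (s th : R)
    (c : nat -> 'rV[R]_n.+1 * 'rV[R]_n.+1) :
  s != 0%R -> (1 < th)%R -> exists c' : nat -> 'rV[R]_n.+1 * 'rV[R]_n.+1,
    (fun x => a + s *: x)%R @` (\bigcup_k obox (c k)) `<=`
      \bigcup_k open_box (c' k) /\
    \sum_(0 <= k <oo) (obox_vol (c' k))%:E =
    (th * `|s| ^+ n.+1)%:E * \sum_(0 <= k <oo) (obox_vol (c k))%:E.
Proof.
move=> s0 th1; pose d := (th `^ n.+1%:R^-1)%R.
have d1 : (1 < d)%R.
  have <- : (1 `^ n.+1%:R^-1 = 1 :> R)%R by rewrite powR1.
  by rewrite gt0_ltr_powR// ?nnegrE ?invr_gt0//; lra.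
have dth : (d ^+ n.+1 = th)%R.
  by rewrite -powR_mulrn ?powR_ge0// /d -powRrM mulVf// powRr1//; lra.
have [c' c'E] := choice (fun k => obox_affine_open_box a (c k) s0 d1).
exists c'; split.
  move=> _ [x [k _ ckx] <-]; exists k => //.
  by have [h _] := c'E k; apply: h; exists x.
rewrite -nneseriesZl => [|k _]; last exact: obox_vol_ge0.
apply: eq_eseriesr => k _; have [_ ->] := c'E k.
by rewrite exprMn dth EFinM.
Qed.

Lemma leb_affine_le (a : 'rV[R]_n.+1) (s : R) A : s != 0%R ->
  leb_outer ((fun x => a + s *: x)%R @` A) <= (`|s| ^+ n.+1)%:E * leb_outer A.
Proof.
move=> s0; have s1 : (0 < `|s| ^+ n.+1)%R by rewrite exprn_gt0// normr_gt0.
rewrite -lee_pdivrMl//; apply: le_ereal_inf_tmp => _ [c Ac <-].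
rewrite lee_pdivrMl//; apply/lee_mul01Pr; first exact: leb_outer_ge0.
move=> r /andP[r0 r1].
have [|c' [c'A c'E]] := @cover_affine_open_box a s r^-1%R c s0.
  by rewrite invf_gt1.
rewrite -[r]invrK lee_pdivrMl ?invr_gt0//.
rewrite muleA -EFinM -c'E; apply: ereal_inf_lbound.
exists c' => // y yA; have [|k _ /open_box_sub ?] := c'A y; last by exists k.
by move: yA => [x /Ac cx <-]; exists x.
Qed.

Lemma leb_affine (a : 'rV[R]_n.+1) (s : R) A : s != 0%R ->
  leb_outer ((fun x => a + s *: x)%R @` A) = (`|s| ^+ n.+1)%:E * leb_outer A.
Proof.
move=> s0; apply/eqP; rewrite eq_le leb_affine_le//=.
have s1 : (0 < `|s| ^+ n.+1)%R by rewrite exprn_gt0// normr_gt0.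
have si : (s^-1 != 0)%R by rewrite invr_eq0.
have := leb_affine_le (- (s^-1 *: a))%R ((fun x => a + s *: x)%R @` A) si.
rewrite normfV exprVn lee_pdivlMl//; congr (_ * _ <= _); congr leb_outer.
have aK x : (- (s^-1 *: a) + s^-1 *: (a + s *: x) = x)%R.
  by rewrite scalerDr addKr scalerA mulVf// scale1r.
apply/seteqP; split => [_ [_ [x Ax <-] <-]|x Ax]; first by rewrite aK.
by exists (a + s *: x)%R; [exists x|rewrite aK].
Qed.

Lemma leb_outer_regular A (e : R) : leb_outer A < +oo -> (0 < e)%R ->
  exists U, [/\ open U, measurable (U : set space), A `<=` U &
    leb_outer U < leb_outer A + e%:E].
Proof.
move=> Aoo e0.
have Afin : leb_outer A \is a fin_num by rewrite ge0_fin_numE// leb_outer_ge0.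
have e2 : (0 < e / 2)%R by lra.
have [_ [c Ac <-] clt] := lb_ereal_inf_adherent e2 Afin.
set S := \sum_(_ <= k <oo) _ in clt.
have S0 : 0 <= S by apply: nneseries_ge0 => k _ _; exact: obox_vol_ge0.
have Sfin : S \is a fin_num.
  by rewrite ge0_fin_numE// (lt_trans clt)// lte_add_pinfty// ltry.
have fS0 : (0 <= fine S)%R by rewrite fine_ge0.
(* chosen so that th * S <= S + e / 2 *)
pose th := (1 + e / 2 / (fine S + 1))%R.
have th1 : (1 < th)%R by rewrite /th ltrDl divr_gt0//; lra.
have [|c' [c'A c'E]] := @cover_affine_open_box 0%R 1%R th c _ th1.
  by rewrite oner_neq0.
exists (\bigcup_k open_box (c' k)); split.
- by apply: bigcup_open => k _; exact: open_open_box.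
- by apply: bigcup_measurable => k _; exact: measurable_open_box.
- by move=> x /Ac cx; apply: c'A; exists x => //; rewrite add0r scale1r.
apply: (@le_lt_trans _ _ (\sum_(0 <= k <oo) (obox_vol (c' k))%:E)).
  apply: ereal_inf_lbound; exists c' => //.
  by move=> x [k _ /open_box_sub ?]; exists k.
rewrite c'E normr1 expr1n mulr1 -/S.
have -> : e%:E = (e / 2)%:E + (e / 2)%:E by rewrite -EFinD -splitr.
rewrite addeA; apply: le_lt_trans (_ : S + (e / 2)%:E < _); last first.
  by rewrite lteD2rE.
rewrite -[S in leLHS]fineK// -[S in leRHS]fineK// -EFinM -EFinD lee_fin /th.
rewrite mulrDl mul1r lerD2l mulrAC -mulrA.
by rewrite ler_piMr ?ler_pdivrMr ?mul1r//; lra.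
Qed.

Section affine_change_of_variables.
Variables (a : 'rV[R]_n.+1) (s : R).
Hypothesis s0 : s != 0%R.

Let T (y : space) : space := (a + s *: (y : 'rV[R]_n.+1))%R.
Let T' (y : space) : space := (s^-1 *: ((y : 'rV[R]_n.+1) - a))%R.

Let T'K : cancel T' T.
Proof. by move=> y; rewrite /T /T' scalerA mulfV// scale1r addrC subrK. Qed.

Let sN_gt0 : (0 < `|s| ^+ n.+1)%R.
Proof. by rewrite exprn_gt0// normr_gt0. Qed.

Lemma leb_affine_preimage A :
  leb ((fun y => a + s *: y)%R @^-1` A) = ((`|s| ^+ n.+1)^-1)%:E * leb A.
Proof.
have -> : leb A = (`|s| ^+ n.+1)%:E * leb ((fun y => a + s *: y)%R @^-1` A).
  rewrite -[RHS](leb_affine a _ s0); congr leb_outer.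
  apply/seteqP; split => [y Ay|_ [y Ay <-]//].
  by exists (T' y); [rewrite /= -[X in A X]/(T (T' y)) T'K|exact: T'K].
by rewrite muleA -EFinM mulVf ?mul1e// gt_eqF.
Qed.

Lemma measurable_affine :
  measurable_fun [set: space] ((fun y => a + s *: y)%R : space -> space).
Proof.
move=> _ A mA; rewrite setTI.
suff h : (leb_outer_measure R n).-caratheodory (T @^-1` A) by exact: h.
move=> X.
have imI (B C : set space) : T @` (B `&` T @^-1` C) = T @` B `&` C.
  apply/seteqP; split => [_ [x [Bx Cx] <-]|y [[x Bx <-] Cx]].
    by split => //; exists x.
  by exists x.
have aff (B : set space) : leb_outer B =
    ((`|s| ^+ n.+1)^-1)%:E * leb_outer (T @` B).
  rewrite -[leb_outer (T @` B)]/(leb_outer ((fun y => a + s *: y)%R @` B)).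
  by rewrite (leb_affine a _ s0) muleA -EFinM mulVf ?mul1e// gt_eqF.
rewrite -[LHS]/(leb_outer X) -[X in (X + _)%R]/(leb_outer _).
rewrite -[X in (_ + X)%R]/(leb_outer _) preimage_setC.
rewrite (aff X) (aff (X `&` T @^-1` A)) (aff (X `&` T @^-1` (~` A))) !imI.
rewrite -ge0_muleDr; try exact: leb_outer_ge0.
congr (_ * _); exact: mA (T @` X).
Qed.

Lemma ge0_integral_affine (f : 'rV[R]_n.+1 -> \bar R) :
  measurable_fun [set: space] f -> (forall y, 0 <= f y) ->
  \int[leb]_y f (a + s *: y)%R = ((`|s| ^+ n.+1)^-1)%:E * \int[leb]_y f y.
Proof.
move=> mf f0.
have si : (0 <= (`|s| ^+ n.+1)^-1)%R by rewrite invr_ge0 ltW.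
transitivity (\int[pushforward leb T]_y f y).
  by rewrite (ge0_integral_pushforward measurable_affine leb measurableT mf).
rewrite -[(_ ^-1)%R]/((NngNum si)%:num) -ge0_integral_mscale//.
have := @eq_measure_integral _ space R setT (mscale (NngNum si) leb)
  (measure_function_pushforward__canonical__measure_function_Measure leb
      measurable_affine).
by apply=> A mA _; exact: (leb_affine_preimage A).
Qed.

Lemma integral_affine (f : 'rV[R]_n.+1 -> R) :
  leb.-integrable [set: space] (EFin \o f) ->
  leb.-integrable [set: space] (fun y => (f (a + s *: y)%R)%:E) /\
  \int[leb]_y (f (a + s *: y)%R)%:E =
    ((`|s| ^+ n.+1)^-1)%:E * \int[leb]_y (f y)%:E.
Proof.
move=> intf; have mf := measurable_int _ intf.
have si : (0 <= (`|s| ^+ n.+1)^-1)%R by rewrite invr_ge0 ltW.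
have mfT : measurable_fun [set: space] (fun y => (f (a + s *: y)%R)%:E).
  exact: (measurableT_comp mf measurable_affine).
split.
  apply/integrableP; split => //.
  have /integrableP[_ foo] := intf.
  rewrite (@ge0_integral_affine (fun y => `|(f y)%:E|)); last 2 first.
  - exact: measurableT_comp.
  - by move=> y; exact: abse_ge0.
  by rewrite lte_mul_pinfty// lee_fin.
rewrite [LHS]integralE [X in _ = _ * X]integralE.
have posE := @ge0_integral_affine (EFin \o f)^\+ (measurable_funepos mf)
  (fun=> funepos_ge0 _ _).
have negE := @ge0_integral_affine (EFin \o f)^\- (measurable_funeneg mf)
  (fun=> funeneg_ge0 _ _).
rewrite muleBr//; last by rewrite fin_num_adde_defr// integrable_pos_fin_num.
rewrite -[X in _ = X - _]posE -[X in _ = _ - X]negE.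
by congr (_ - _); apply: eq_integral => y _; rewrite ?funeposE ?funenegE.
Qed.

End affine_change_of_variables.

Lemma affine_ball (a x : 'rV[R]_n.+1) (s r : R) : (0 < s)%R ->
  (fun y => a + s *: y)%R @` ball x r = ball (a + s *: x)%R (s * r)%R.
Proof.
move=> s0; rewrite !mx_norm_ball /ball_; apply/seteqP; split => [_ [y + <-]|y] /=.
  by move=> ?; rewrite opprD addrACA subrr add0r -scalerBr normrZ gtr0_norm//
      ltr_pM2l.
move=> xy; exists (s^-1 *: (y - a))%R.
  rewrite -(ltr_pM2l s0) -[X in (X * `|_|)%R]gtr0_norm// -normrZ.
  rewrite scalerBr scalerA mulfV ?gt_eqF// scale1r opprB.
  by rewrite addrA [(s *: x + a)%R]addrC.
by rewrite scalerA mulfV ?gt_eqF// scale1r addrC subrK.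
Qed.

Lemma leb_ball_affine (a x : 'rV[R]_n.+1) (s r : R) : (0 < s)%R ->
  leb (ball (a + s *: x)%R (s * r)%R) = (s ^+ n.+1)%:E * leb (ball x r).
Proof.
move=> s0; rewrite -affine_ball//.
rewrite -[LHS]/(leb_outer _) leb_affine ?gt_eqF//.
by rewrite gtr0_norm.
Qed.

(** If one cube is null then so are all its affine images, hence the whole
    space. *)
Lemma leb_ball_gt0 x (r : R) : leb [set: space] != 0 -> (0 < r)%R ->
  0 < leb (ball x r).
Proof.
move=> leb0 r0; rewrite lt_neqAle measure_ge0 andbT;
    apply: contra_neq leb0 => /esym h.
have h0 (k : nat) : leb (ball (0 : 'rV[R]_n.+1)%R k.+1%:R) = 0.
  have := @leb_ball_affine (- ((k.+1%:R / r) *: x))%R x (k.+1%:R / r)%R r.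
  by rewrite addNr divfK ?gt_eqF// h mule0; apply; rewrite divr_gt0.
have -> : [set: space] = \bigcup_k ball (0 : 'rV[R]_n.+1)%R k.+1%:R.
  apply/esym; rewrite -subTset => y _;
      exists (Num.truncn `|(y : 'rV[R]_n.+1)|) => //.
  by rewrite mx_norm_ball /ball_/= sub0r normrN truncnS_gt.
apply/eqP; rewrite eq_le measure_ge0 andbT.
apply: le_trans (leb_outer_sigma_subadditive _) _.
by rewrite eseries0// => k _ _; exact: h0.
Qed.

(** * Density points *)

Lemma rat_approx x (r : R) : (0 < r)%R ->
  exists q : 'rV[rat]_n.+1, ball x r (map_mx ratr q).
Proof.
move=> r0.
have /choice[q qx] (i : 'I_n.+1) : exists q : rat, (`|x 0 i - ratr q| < r)%R.
  have [|q] := @rat_in_itvoo R (x 0 i - r)%R (x 0 i + r)%R; first lra.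
  by rewrite in_itv/= => /andP[h1 h2]; exists q; rewrite ltr_norml;
      apply/andP; split; lra.
exists (\row_i q i)%R; apply/(ball_coordP _ _ r0) => i; rewrite !mxE; exact: qx.
Qed.

Lemma measure_bigsetU_seq_le (I : eqType) (s : seq I) (F : I -> set space) :
  (forall i, measurable (F i)) ->
  leb (\big[setU/set0]_(i <- s) F i) <= \sum_(i <- s) leb (F i).
Proof.
move=> mF; elim: s => [|i s IH]; first by rewrite !big_nil measure0.
rewrite !big_cons; apply: le_trans (leeD2l _ IH).
by apply: measureU2 => //; apply: bigsetU_measurable => j _; exact: mF.
Qed.

(** The cubes on which the mean of f is large are replaced by cubes with
    rational centre and radius, so that finitely many of them exhaust the union
    up to a small measure and the finite covering lemma applies. *)
Lemma vitali_weak_type (f : 'rV[R]_n.+1 -> \bar R) (U B : set 'rV[R]_n.+1) (e : R) :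
  measurable_fun [set: space] f -> (forall y, 0 <= f y) ->
  open U -> measurable (U : set space) -> (0 < e)%R -> B `<=` U ->
  (forall x, B x -> forall d : R, (0 < d)%R -> exists r : R,
    [/\ (0 < r)%R, (r < d)%R &
      (e * r ^+ n.+1)%:E < \int[leb]_(y in ball x r) f y]) ->
  leb_outer B <= (12 ^+ n.+1 / e)%:E * \int[leb]_(y in U) f y.
Proof.
move=> mf f0 oU mU e0 BU Bf.
have mball (x : 'rV[R]_n.+1) (r : R) : measurable (ball x r : set space).
  exact: measurable_ball_space.
have fle (C D : set space) : measurable C -> measurable D -> C `<=` D ->
    \int[leb]_(y in C) f y <= \int[leb]_(y in D) f y.
  move=> mC mD; apply: ge0_subset_integral => //.
  exact: measurable_funTS.
pose b (q : 'rV[rat]_n.+1 * rat) : 'rV[R]_n.+1 * R := (map_mx ratr q.1, ratr q.2).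
pose P (c : 'rV[R]_n.+1 * R) := [/\ (0 < c.2)%R, ball c.1 c.2 `<=` U &
  (e * (c.2 / 2) ^+ n.+1)%:E <= \int[leb]_(y in ball c.1 c.2) f y].
pose t k := if unpickle k is Some q then
  if `[< P (b q) >] then ball (b q).1 (b q).2 else set0 else set0.
have mt k : measurable (t k : set space).
  by rewrite /t; case: unpickle => // q; case: ifPn.
have Bt : B `<=` \bigcup_k t k.
  move=> x Bx; have /nbhs_ballP[r0 /= r00 xU] : nbhs x U.
    by apply: open_nbhs_nbhs; split => //; exact: BU.
  have [|r [rgt0 r3 fr]] := Bf x Bx (r0 / 3)%R; first by rewrite divr_gt0.
  have [|c cx] := @rat_approx x (r / 2)%R; first by rewrite divr_gt0.
  (* a rational cube of radius p in ]3r/2, 2r[ whose centre is r/2-close to x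
     contains the cube of radius r, and lies in the cube of radius 3r *)
  have [|p] := @rat_in_itvoo R (3 / 2 * r)%R (2 * r)%R; first lra.
  rewrite in_itv/= => /andP[p1 p2].
  exists (pickle (c, p)) => //; rewrite /t pickleK.
  have xc : ball x r `<=` ball (map_mx ratr c : 'rV[R]_n.+1) (ratr p).
    move=> y xy; apply: (@le_ball _ _ _ (r / 2 + r)%R); first lra.
    exact: ball_triangle (ball_sym cx) xy.
  rewrite ifT; first by apply: xc; exact: ballxx.
  apply/asboolP; split => /=.
  - lra.
  - move=> y cy; apply: xU; apply: (@le_ball _ _ _ (r / 2 + ratr p)%R); first lra.
    exact: ball_triangle cx cy.
  - apply: le_trans (fle _ _ (mball _ _) (mball _ _) xc).
    apply: le_trans (ltW fr); rewrite lee_fin ler_pM2l// lerXn2r// ?nnegrE; lra.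
(* 12 = 3 * 2 * 2: 3 from the covering lemma, 2 from the diameter of a cube, and
   2 from the passage from r to a rational radius below 2r *)
set C := (12 ^+ n.+1 / e)%R.
have C0 : (0 < C)%R by rewrite divr_gt0// exprn_gt0.
pose W M := \big[setU/set0]_(k < M) t k.
have mW M : measurable (W M : set space) by exact: bigsetU_measurable.
have W_cvg : leb (W M) @[M --> \oo] --> leb (\bigcup_M W M).
  apply: (@nondecreasing_cvg_mu _ space R leb W) => //.
    exact: bigcup_measurable.
  by move=> i j ij; apply/subsetPset; exact: subset_bigsetU.
have BW : B `<=` \bigcup_M W M.
  by move=> x /Bt[k _ tk]; exists k.+1 => //; rewrite /W big_ord_recr; right.
apply: le_trans (le_leb_outer BW) _; rewrite -[leLHS]/(leb _).
rewrite -(cvg_lim _ W_cvg)//; apply: lime_le; first by apply/cvg_ex; eexists;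
    exact: W_cvg.
apply: nearW => M.
pose s := [seq b q | q <- pmap unpickle (iota 0 M) & `[< P (b q) >]].
have sP (c : 'rV[R]_n.+1 * R) : c \in s -> P c by move=> /mapP[q];
    rewrite mem_filter => /andP[/asboolP ? _ ->].
have [c /sP[]//|D [uD Ds tD sD]] := @finite_vitali R _ s.
have DP (c : 'rV[R]_n.+1 * R) : c \in D -> P c by move=> /Ds /sP.
have WD : W M `<=` \big[setU/set0]_(c <- D) ball c.1 (3 * c.2)%R.
  move=> y; rewrite /W -(bigcup_mkord M t) => -[k /= kM].
  rewrite /t; case ukq : (unpickle k) => [q|//]; case: ifPn => // /asboolP Pq bq.
  have [|d dD bd] := sD (b q).
    apply/mapP; exists q => //; rewrite mem_filter; apply/andP; split;
        first exact/asboolP.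
    by rewrite mem_pmap -ukq; apply: map_f; rewrite mem_iota.
  by rewrite -bigcup_seq; exists d => //; exact: bd.
apply: le_trans (le_leb_outer WD : leb (W M) <= leb _) _.
apply: le_trans (measure_bigsetU_seq_le _ _) _ => //.
apply: (@le_trans _ _ (\sum_(c <- D) C%:E * \int[leb]_(y in ball c.1 c.2) f y)).
  rewrite big_seq [leRHS]big_seq; apply: lee_sum => c /DP[c0 _ cf].
  apply: le_trans (leb_ball_le _ _) _; first lra.
  rewrite -lee_pdivrMl//; apply: le_trans cf; rewrite -EFinM lee_fin /C.
  have -> : ((12 : R) = 4 * 3)%R by ring.
  rewrite !invfM !invrK exprMn [in leRHS]exprMn.
  have -> : ((4 : R) ^+ n.+1 = 2 ^+ n.+1 * 2 ^+ n.+1)%R.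
    by rewrite -exprMn; congr (_ ^+ _)%R; ring.
  have h2 : ((2 : R) ^+ n.+1 != 0)%R by rewrite expf_neq0.
  have h3 : ((3 : R) ^+ n.+1 != 0)%R by rewrite expf_neq0.
  rewrite le_eqVlt; apply/orP; left; apply/eqP.
  by rewrite ?exprMn ?exprVn; field; rewrite h2 h3.
rewrite -ge0_sume_distrr; last by move=> c _; apply: integral_ge0.
rewrite lee_pmul2l//.
rewrite -(@ge0_integral_bigsetU _ space R leb _ (fun c : 'rV[R]_n.+1 * R =>
    ball c.1 c.2))//.
- apply: fle => //; first exact: bigsetU_measurable.
  by rewrite -bigcup_seq => y [c /= /DP[_ cU _]]; exact: cU.
- exact: measurable_funTS.
Qed.

Lemma leb_outer0_negligible A : leb_outer A = 0 -> leb.-negligible (A : set space).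
Proof.
move=> A0; exists A; split => //.
suff h : (leb_outer_measure R n).-caratheodory A by exact: h.
apply: le_caratheodory_measurable => X.
rewrite -[X in X + _]/(leb_outer _) -[X in _ + X]/(leb_outer _).
rewrite -[leRHS]/(leb_outer _).
have -> : leb_outer (X `&` A) = 0.
  by apply/eqP; rewrite eq_le leb_outer_ge0 andbT -A0; apply: le_leb_outer;
      exact: subIsetr.
by rewrite add0e; apply: le_leb_outer; exact: subIsetl.
Qed.

Lemma ae_leb_imply (P Q : 'rV[R]_n.+1 -> Prop) :
  {ae leb, forall x, P x} -> (forall x, P x -> Q x) -> {ae leb, forall x, Q x}.
Proof. by move=> aP PQ; apply: negligibleS aP => x nQ /PQ. Qed.

Lemma ae_leb_and (P Q : 'rV[R]_n.+1 -> Prop) :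
  {ae leb, forall x, P x} -> {ae leb, forall x, Q x} ->
  {ae leb, forall x, P x /\ Q x}.
Proof.
move=> aP aQ; apply: negligibleS (negligibleU aP aQ) => x /not_andP[nP|nQ].
  by left.
by right.
Qed.

(** Absolute continuity of the integral, for extended-real functions. *)
Lemma integral_small_measure (f : 'rV[R]_n.+1 -> \bar R) (e : R) :
  measurable_fun [set: space] f -> (forall y, 0 <= f y) ->
  \int[leb]_y f y < +oo -> (0 < e)%R ->
  exists2 d : R, (0 < d)%R & forall A : set space, measurable A -> leb A < d%:E ->
    \int[leb]_(y in A) f y < e%:E.
Proof.
move=> mf f0 foo e0.
have fi : leb.-integrable [set: space] f.
  apply/integrableP; split => //.
  by under eq_integral do rewrite gee0_abs//.
have finef : leb.-integrable [set: space] (EFin \o (fine \o f)).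
  apply: (le_integrable measurableT _ _ fi).
    by apply/measurable_EFinP; apply: measurableT_comp => //;
        exact: fine_measurable.
  by move=> y _ /=; case: (f y) => [r||]; rewrite /= ?lexx ?normr0 ?leey.
have [d [d0 df]] := integral_normr_continuous finef e0.
exists d => // A mA Ad.
have mfA : measurable_fun (A : set space) f by exact: measurable_funTS.
have iA : leb.-integrable A f by exact: (integrableS measurableT mA).
have mfine : measurable_fun (A : set space) (EFin \o (fine \o f)).
  by apply: measurable_funTS; exact: measurable_int finef.
have -> : \int[leb]_(y in A) f y = \int[leb]_(y in A) (EFin \o (fine \o f)) y.
  apply: ge0_ae_eq_integral => //.
    by move=> y _; rewrite /= lee_fin fine_ge0.
  by apply: filterS (integrable_ae mA iA) => y fy Ay; rewrite /= fineK// fy.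
have := df A mA Ad; rewrite -lte_fin; apply: le_lt_trans.
rewrite fineK; last first.
  rewrite ge0_fin_numE; last by apply: integral_ge0 => y _; rewrite lee_fin.
  have /integrableP[_] := integrableS measurableT mA (@subsetT _ _) finef.
  by [].
apply: ge0_le_integral.
- exact: mA.
- by move=> y _; rewrite /= lee_fin fine_ge0.
- exact: mfine.
- by apply/measurable_EFinP; apply: measurableT_comp => //; apply/measurable_EFinP.
- by move=> y _; rewrite /= lee_fin ler_norm.
Qed.

(** The mean is normalized by the power of the radius instead of the measure
    of the cube, which is proportional to it. *)
Definition vanishing_mean (f : 'rV[R]_n.+1 -> \bar R) x :=
  forall e : R, (0 < e)%R ->
  exists2 d : R, (0 < d)%R & forall r : R, (0 < r)%R -> (r < d)%R ->
    \int[leb]_(y in ball x r) f y <= (e * r ^+ n.+1)%:E.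

(** Absolute continuity of the integral gives open sets around E on which f
    has an arbitrarily small integral, and the weak type bound on these sets
    bounds the measure of the exceptional points. *)
Lemma zero_density (f : 'rV[R]_n.+1 -> \bar R) (E : set space) :
  measurable_fun [set: space] f -> (forall y, 0 <= f y) ->
  \int[leb]_y f y < +oo -> measurable E -> leb E < +oo ->
  (forall x, E x -> f x = 0) ->
  {ae leb, forall x, E x -> vanishing_mean f x}.
Proof.
move=> mf f0 foo mE Eoo fE.
pose Bad (m : nat) := [set x : 'rV[R]_n.+1 | E x /\
  forall d : R, (0 < d)%R -> exists r : R, [/\ (0 < r)%R, (r < d)%R &
   (m.+1%:R^-1 * r ^+ n.+1)%:E < \int[leb]_(y in ball x r) f y]].
have Bad0 m : leb_outer (Bad m) = 0.
  apply/eqP; rewrite eq_le leb_outer_ge0 andbT; apply/lee_addgt0Pr => h h0.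
  rewrite add0e.
  have m0 : (0 < m.+1%:R^-1 :> R)%R by rewrite invr_gt0.
  set C := (12 ^+ n.+1 / m.+1%:R^-1 : R)%R.
  have C0 : (0 < C)%R by rewrite divr_gt0// exprn_gt0.
  have [|d d0 df] := @integral_small_measure f (h / C)%R mf f0 foo.
    by rewrite divr_gt0.
  have [U [oU mU EU UE]] := leb_outer_regular Eoo d0.
  apply: (@le_trans _ _ (C%:E * \int[leb]_(y in U) f y)).
    apply: vitali_weak_type => //; first by move=> x [/EU].
    by move=> x [].
  rewrite -lee_pdivlMl// -EFinM [X in _ <= X%:E]mulrC; apply/ltW.
  have mUE : measurable (U `\` E : set space) by exact: measurableD.
  have -> : \int[leb]_(y in U) f y = \int[leb]_(y in (U `\` E : set space)) f y.
    rewrite -[in LHS](setDUK EU) ge0_integral_setU//.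
    - by rewrite integral0_eq ?add0e// => y /fE.
    - exact: measurable_funTS.
    - by apply/disj_set2P/seteqP; split => // y [? []].
  apply: df => //.
  rewrite measureD// ?setIidr//; last first.
    by apply: lt_le_trans UE _; exact: leey.
  have Efin : leb E \is a fin_num by rewrite ge0_fin_numE.
  by rewrite lteBlDr// addeC.
have : leb.-negligible (\bigcup_m Bad m : set space).
  apply: negligible_bigcup => m; exact: leb_outer0_negligible.
apply: negligibleS => x /not_implyP[Ex /existsNP[e /not_implyP[e0 nd]]].
exists (Num.truncn e^-1) => //; split => // d d0.
apply: contrapT => nr; apply: nd; exists d => // r r0 rd.
rewrite leNgt; apply/negP => lt_er; apply: nr; exists r; split => //.
apply: le_lt_trans lt_er; rewrite lee_fin ler_pM2r ?exprn_gt0//.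
by rewrite -[leRHS]invrK lef_pV2 ?posrE ?invr_gt0// ltW// truncnS_gt.
Qed.

(** * Lebesgue points of functions with values in l^1 *)

Section lebesgue_points.
Variable g : nat -> 'rV[R]_n.+1 -> R.
Hypothesis mg : forall k, measurable_fun [set: space] (g k).
Hypothesis gfin : forall B : set space, measurable B -> leb B < +oo ->
  \int[leb]_(y in B) (\sum_(0 <= k <oo) `|g k y|%:E) < +oo.

Let ball0 (N : nat) : set space := ball (0 : 'rV[R]_n.+1)%R N.+1%:R.

Let mball0 N : measurable (ball0 N).
Proof. exact: measurable_ball_space. Qed.

(** Restricting the excess to a cube makes it integrable; the centres, the
    thresholds and the cubes range over countable sets, so that one null set
    serves them all. *)
Let cut (t : seq rat * nat * nat) : space -> \bar R :=
  let: (c, m, N) := t in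
  (l1_excess g (fun k => ratr c`_k) m.+1%:R^-1) \_ (ball0 N).

Let cut_ge0 t y : 0 <= cut t y.
Proof.
case: t => [[c m] N]; rewrite /cut patchE; case: ifP => _; last exact: lexx.
exact: l1_excess_ge0.
Qed.

Let measurable_cut t : measurable_fun [set: space] (cut t).
Proof.
case: t => [[c m] N]; apply/(measurable_restrictT _ (mball0 N)).
by apply: measurable_funTS; exact: measurable_l1_excess.
Qed.

Let cut_fin t : \int[leb]_y cut t y < +oo.
Proof.
case: t => [[c m] N]; rewrite /cut -integral_mkcond.
apply: integral_l1_excess_fin.
- exact: mg.
- by rewrite invr_ge0.
- exact: mball0.
- exact: leb_ball_fin.
- exact: l1_rat_fin.
- under eq_integral do rewrite l1_dist0.
  by apply: gfin; [exact: mball0|exact: leb_ball_fin].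
Qed.

Let ae_l1_fin : {ae leb, forall y, \sum_(0 <= k <oo) `|g k y|%:E < +oo}.
Proof.
have : {ae leb, forall y, forall N, cut ([::], 0%N, N) y < +oo}.
  apply: ae_foralln => N.
  have : leb.-integrable [set: space] (cut ([::], 0%N, N)).
    apply/integrableP; split; first exact: measurable_cut.
    rewrite (eq_integral (cut ([::], 0%N, N))); first exact: cut_fin.
    by move=> y _; rewrite gee0_abs ?cut_ge0.
  move=> /(integrable_ae measurableT); apply: filterS => y /(_ I).
  by rewrite ge0_fin_numE ?cut_ge0.
move=> /ae_leb_imply; apply => y yN; set N := Num.truncn `|y : 'rV[R]_n.+1|.
have yb : ball0 N y.
  by rewrite /ball0 mx_norm_ball /ball_/= sub0r normrN truncnS_gt.
have := yN N; rewrite /cut patchE mem_set// => cy.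
rewrite -l1_dist0; apply: le_lt_trans (l1_dist_triangle _ _ (fun k => ratr
    [::]`_k) _) _.
rewrite lte_add_pinfty//.
  apply: le_lt_trans (l1_dist_le_excess _ _ 1%:R^-1 _) _.
  by rewrite lte_add_pinfty// ltry.
by apply: le_lt_trans (l1_rat_fin R [::]); apply/lee_nneseries => k *;
    rewrite ?subr0 ?lee_fin.
Qed.

(** If c is within e of g(x) in l^1, the positive part of |g - c| - e vanishes
    at x, so by density its means at x tend to 0; and |g - g(x)| exceeds it by
    at most 2e. *)
Lemma lebesgue_points : {ae leb, forall x,
  \sum_(0 <= k <oo) `|g k x|%:E < +oo /\
  vanishing_mean (l1_dist g (g ^~ x)) x}.
Proof.
have : {ae leb, forall x, forall k,
    if unpickle k is Some t then
      (cut t x = 0 /\ ball0 t.2 x) -> vanishing_mean (cut t) x else True}.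
  apply: ae_foralln => k; case: unpickle => [t|]; last exact: aeW.
  have mE : measurable (ball0 t.2 `&` cut t @^-1` [set 0]).
    apply: measurableI; first exact: mball0.
    by rewrite -[X in measurable X]setTI; apply: (measurable_cut t).
  have := @zero_density (cut t) _ (@measurable_cut t) (cut_ge0 t) (cut_fin t) mE.
  have Eoo : leb (ball0 t.2 `&` cut t @^-1` [set 0]) < +oo.
    apply: le_lt_trans (leb_ball_fin (0 : 'rV[R]_n.+1)%R t.2.+1%:R).
    by apply: le_leb_outer; exact: subIsetl.
  move=> /(_ Eoo)-/(_ (fun x => @proj2 _ _)); move=> /ae_leb_imply;
      apply => x h [h1 h2].
  exact: h.
move=> /(ae_leb_and ae_l1_fin)/ae_leb_imply; apply => x [Gx xt]; split=> // e e0.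
pose K := (2 ^+ n.+1 : R)%R.
have K0 : (0 < K)%R by exact: exprn_gt0.
(* the excess 2 dl on a cube of volume at most (2r)^(n+1) costs e r^(n+1) / 2 *)
pose dl := (e / (4 * K))%R.
have dl0 : (0 < dl)%R by rewrite divr_gt0// mulr_gt0.
pose m := Num.truncn dl^-1.
have m0 : (0 < m.+1%:R^-1 :> R)%R by rewrite invr_gt0.
have mdl : (m.+1%:R^-1 <= dl)%R.
  by rewrite -[leRHS]invrK lef_pV2 ?posrE ?invr_gt0// ltW// truncnS_gt.
have [c cx] := l1_rat_dense m0 Gx.
pose N := Num.truncn (`|x : 'rV[R]_n.+1| + 1)%R.
have xN : ball (x : 'rV[R]_n.+1) 1%R `<=` ball0 N.
  move=> y; rewrite /ball0 mx_norm_ball /ball_/= sub0r normrN => xy.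
  apply: le_lt_trans (truncnS_gt _).
  by have := ler_distD (x : 'rV[R]_n.+1) y 0%R; rewrite !subr0 distrC; lra.
have xb : ball0 N x by apply: xN; exact: ballxx.
have cutx : cut (c, m, N) x = 0.
  rewrite /cut patchE mem_set//; apply/max_idPr.
  by rewrite leeBlDr// add0e ltW.
have := xt (pickle (c, m, N)); rewrite pickleK => /(_ (conj cutx xb)).
have e2 : (0 < e / 2)%R by rewrite divr_gt0.
move=> /(_ _ e2)[d d0 xd]; exists (Num.min d 1)%R; first by rewrite lt_min d0 ltr01.
move=> r r0; rewrite lt_min => /andP[rd r1].
have mB : measurable (ball (x : 'rV[R]_n.+1) r : set space)
    by exact: measurable_ball_space.
have mcut : measurable_fun (ball (x : 'rV[R]_n.+1) r : set space) (cut (c, m, N)).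
  by apply: measurable_funTS; exact: measurable_cut.
have mD (c' : nat -> R) : measurable_fun (ball (x : 'rV[R]_n.+1) r : set
    space) (l1_dist g c').
  by apply: measurable_funTS; exact: measurable_l1_dist.
have mcst (a : \bar R) : measurable_fun (ball (x : 'rV[R]_n.+1) r : set space)
    (fun=> a).
  exact: measurable_cst.
apply: (@le_trans _ _ (\int[leb]_(y in ball (x : 'rV[R]_n.+1) r)
    (cut (c, m, N) y + (2 * m.+1%:R^-1)%:E))).
  apply: ge0_le_integral.
  - exact: mB.
  - by move=> y _; exact: l1_dist_ge0.
  - exact: mD.
  - by apply: emeasurable_funD.
  - move=> y xy; apply: le_trans (l1_dist_triangle _ _ (fun k => ratr c`_k) y) _.
    have yN : ball0 N y by apply: xN; apply: le_ball xy; exact: ltW.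
    rewrite /cut patchE mem_set// mulrDl mul1r EFinD addeA; apply: leeD.
      exact: l1_dist_le_excess.
    by under eq_eseriesr do rewrite distrC; exact: ltW.
rewrite ge0_integralD; last 5 first.
- exact: mB.
- by move=> y _; exact: cut_ge0.
- exact: mcut.
- by move=> y _; rewrite lee_fin mulr_ge0.
- exact: mcst.
rewrite integral_cst; last exact: mB.
apply: (@le_trans _ _ ((e / 2 * r ^+ n.+1)%:E +
    (2 * m.+1%:R^-1)%:E * ((2 * r) ^+ n.+1)%:E)).
  apply: leeD; first exact: xd.
  by rewrite lee_pmul2l ?lte_fin ?mulr_gt0//; exact: leb_ball_le.
rewrite -EFinM -EFinD lee_fin exprMn -/K.
have -> : (e * r ^+ n.+1 = e / 2 * r ^+ n.+1 + 2 * dl * (K * r ^+ n.+1))%R.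
  by rewrite /dl; field; rewrite gt_eqF.
by rewrite lerD2l ler_wpM2r ?mulr_ge0 ?exprn_ge0 ?ler_pM2l// ltW.
Qed.

End lebesgue_points.

(** * Kernels with an integrable radial majorant *)

Lemma norm_le_enorm x : (`|x| <= enorm x)%R.
Proof.
rewrite [leLHS]mx_normrE; apply/bigmax_leP; split=> [|[i j] _].
  exact: sqrtr_ge0.
rewrite /= ord1 -sqrtr_sqr ler_wsqrtr// (bigD1 j)//= lerDl.
by apply: sumr_ge0 => k _; exact: sqr_ge0.
Qed.

Lemma coord_le_norm x (i : 'I_n.+1) : (`|x 0 i| <= `|x|)%R.
Proof. by rewrite [leRHS]mx_normrE; exact: (le_bigmax _ _ (0, i)%R). Qed.

Lemma enorm_le_norm x : (enorm x <= n.+1%:R * `|x|)%R.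
Proof.
rewrite /enorm -[leRHS]ger0_norm ?mulr_ge0// -sqrtr_sqr ler_wsqrtr//.
apply: (@le_trans _ _ (\sum_(i < n.+1) `|x| ^+ 2)%R).
  by apply: ler_sum => i _; rewrite -real_normK ?num_real// lerXn2r ?nnegrE//
      coord_le_norm.
rewrite sumr_const card_ord -[leLHS]mulr_natl exprMn ler_wpM2r ?sqr_ge0//.
by rewrite expr2 ler_peMl ?ler1n.
Qed.

Definition shell (r : R) : set 'rV[R]_n.+1 := [set y | (r <= `|y| < 2 * r)%R].

Lemma shell_ballE (r : R) : shell r = ball (0 : 'rV[R]_n.+1)%R (2 * r)%R `\`
    ball (0 : 'rV[R]_n.+1)%R r.
Proof.
rewrite !mx_norm_ball /ball_; apply/seteqP; split => y /=; rewrite sub0r normrN.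
  by move=> /andP[h1 ->]; split => //; apply/negP; rewrite -leNgt.
by move=> [h1 /negP]; rewrite -leNgt => h2; apply/andP.
Qed.

Lemma measurable_shell (r : R) : measurable (shell r : set space).
Proof. by rewrite shell_ballE; apply: measurableD;
    exact: measurable_ball_space. Qed.

Lemma leb_shell (r : R) : (0 < r)%R ->
  leb (shell r) = (r ^+ n.+1)%:E * leb (shell 1%R).
Proof.
move=> r0; have := @leb_affine 0%R r (shell 1%R); rewrite gt_eqF//.
rewrite gtr0_norm// => /(_ isT) <-; congr leb_outer.
apply/seteqP; split => [y /andP[h1 h2]|_ [y /andP[h1 h2] <-]].
  exists (r^-1 *: y)%R; last by rewrite add0r scalerA mulfV ?gt_eqF// scale1r.
  rewrite /shell/= normrZ gtr0_norm ?invr_gt0// mulr1.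
  by rewrite mulrC ler_pdivlMr// mul1r h1 ltr_pdivrMr.
rewrite /shell/= add0r normrZ gtr0_norm// ler_peMr ?(ltW r0)//=.
by rewrite mulrC ltr_pM2r//; move: h2; rewrite mulr1.
Qed.

(** The shell contains the cube of radius 1/2 around the point with all
    coordinates equal to 3/2. *)
Lemma leb_shell_gt0 : leb [set: space] != 0 -> 0 < leb (shell 1%R).
Proof.
move=> leb0; pose a : 'rV[R]_n.+1 := const_mx (3 / 2)%R.
have h : (0 < 1 / 2 :> R)%R by [].
apply: lt_le_trans (leb_ball_gt0 a leb0 h) _.
apply: le_leb_outer => y /(ball_coordP _ _ h) ya.
apply/andP; split.
  apply: le_trans (coord_le_norm y ord0).
  by have := ya ord0; rewrite mxE ltr_norml ler_normr => /andP[h1 h2];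
      apply/orP; left; lra.
have /ball_coordP : forall i : 'I_n.+1, (`|(0 : 'rV[R]_n.+1) 0 i - y 0 i| < 2)%R.
  by move=> i; have := ya i; rewrite !mxE !ltr_norml => /andP[h1 h2];
      apply/andP; split; lra.
by move=> /(_ (ltr0Sn _ _)); rewrite mx_norm_ball /ball_/= sub0r normrN mulr1.
Qed.

Lemma trivIset_shell (m : R) : (0 < m)%R ->
  trivIset setT (fun k => shell (dyadic R k * m)%R : set space).
Proof.
move=> m0; apply/trivIsetP => i j _ _ ij;
    rewrite -subset0 => y [/andP[i1 i2] /andP[j1 j2]].
have [h|h] := dyadic_sep R ij.
- have := ler_wpM2r (ltW m0) h; lra.
- have := ler_wpM2r (ltW m0) h; lra.
Qed.

Lemma radial_majorant_tail (phi : 'rV[R]_n.+1 -> R) (r : R) x : (enorm x < r)%R ->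
  ereal_sup [set (`|phi y|)%:E | y in [set y | (r <= enorm y)%R]] <=
  radial_majorant phi x.
Proof.
move=> xr; apply: ereal_sup_le => _ [y ry <-].
by exists y => //=; exact: lt_le_trans ry.
Qed.

(** The supremum of |phi| outside the Euclidean ball of radius 2^k is a lower
    bound of the majorant inside that ball. Shells for the maximum norm,
    shrunk by a dimensional factor, lie inside these Euclidean balls. *)
Lemma potential_shell_bound (phi : 'rV[R]_n.+1 -> R) :
  leb [set: space] != 0 -> 
  leb.-integrable [set: space] (radial_majorant phi) ->
  exists b : nat -> R, [/\ (forall k, 0 <= b k)%R,
    \sum_(0 <= k <oo) (b k * dyadic R k ^+ n.+1)%:E < +oo &
    forall k y, (dyadic R k <= `|y|)%R -> (`|phi y| <= b k)%R].
Proof.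
move=> leb0 iPhi.
pose a k := maxe 0 (ereal_sup [set (`|phi y|)%:E | y in [set y | (dyadic R k
    <= enorm y)%R]]).
have a0 k : 0 <= a k by rewrite /a le_max lexx.
(* the outer radius of the shell is doubled, and the Euclidean norm is at most
   n.+1 times the maximum norm *)
pose M := (2 * n.+1%:R : R)%R.
have M0 : (0 < M)%R by rewrite mulr_gt0.
have Mi0 : (0 < M^-1)%R by rewrite invr_gt0.
set Phi := radial_majorant phi in iPhi.
(* a form of the majorant that is nonnegative by construction *)
pose Phi0 y := maxe 0 (Phi y).
have mPhi : measurable_fun [set: space] Phi := measurable_int _ iPhi.
have mPhi0 : measurable_fun [set: space] Phi0.
  by apply: measurable_maxe => //; exact: measurable_cst.
have Phi00 y : 0 <= Phi0 y by rewrite /Phi0 le_max lexx.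
have Phi0oo : \int[leb]_y Phi0 y < +oo.
  have /integrableP[_] := iPhi; apply: le_lt_trans.
  apply: ge0_le_integral.
  - exact: measurableT.
  - by move=> y _; exact: Phi00.
  - exact: mPhi0.
  - exact: measurableT_comp.
  - by move=> y _; rewrite /Phi0 ge_max abse_ge0/= lee_abs.
have aPhi k y : shell (dyadic R k * M^-1)%R y -> a k <= Phi0 y.
  move=> /andP[_ yk]; rewrite /a /Phi0 ge_max !le_max lexx/=.
  apply/orP; right; apply: radial_majorant_tail.
  apply: le_lt_trans (enorm_le_norm _) _.
  have -> : dyadic R k = (n.+1%:R * (2 * (dyadic R k * M^-1)))%R.
    by rewrite /M; field; rewrite addrC natr1 pnatr_eq0.
  by rewrite ltr_pM2l.
have sum_le : \sum_(0 <= k <oo) (a k * leb (shell (dyadic R k * M^-1)%R)) <=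
    \int[leb]_y Phi0 y.
  pose F k : set space := shell (dyadic R k * M^-1)%R.
  have mF k : measurable (F k) by exact: measurable_shell.
  apply: (@le_trans _ _ (\int[leb]_(y in \bigcup_k F k) Phi0 y)); last first.
    apply: ge0_subset_integral.
    - exact: bigcup_measurable.
    - exact: measurableT.
    - exact: mPhi0.
    - by move=> y _; exact: Phi00.
    - exact: subsetT.
  rewrite ge0_integral_bigcup; last 4 first.
  - exact: mF.
  - exact: measurable_funTS.
  - by move=> y _; exact: Phi00.
  - exact: trivIset_shell.
  apply: lee_nneseries => k _; first by move=> _; apply: mule_ge0 => //;
      exact: measure_ge0.
  rewrite -[X in X <= _](integral_cst leb (mF k)).
  apply: ge0_le_integral.
  - exact: mF.
  - by move=> y _; exact: a0.
  - exact: measurable_cst.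
  - exact: measurable_funTS.
  - by move=> y; exact: aPhi.
have shell_fin : leb (shell 1%R) < +oo.
  apply: le_lt_trans (leb_ball_fin (0 : 'rV[R]_n.+1)%R (2 * 1)%R).
  by apply: le_leb_outer; rewrite shell_ballE; exact: subDsetl.
have shell_gt0 := leb_shell_gt0 leb0.
have kfin : leb (shell 1%R) \is a fin_num by rewrite ge0_fin_numE// ltW.
pose kap := fine (leb (shell 1%R)).
have kap0 : (0 < kap)%R by rewrite fine_gt0// shell_gt0.
pose C := (M^-1 ^+ n.+1 * kap)%R.
have C0 : (0 < C)%R by rewrite mulr_gt0// exprn_gt0.
have sum_fin : \sum_(0 <= k <oo) (a k * (dyadic R k ^+ n.+1)%:E) < +oo.
  suff : C%:E * \sum_(0 <= k <oo) (a k * (dyadic R k ^+ n.+1)%:E) < +oo.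
    by rewrite !ltey; apply: contra_neq => ->; rewrite gt0_muley ?lte_fin.
  rewrite -nneseriesZl; last first.
    by move=> k _; apply: mule_ge0 => //;
        rewrite lee_fin exprn_ge0// ltW// dyadic_gt0.
  apply: le_lt_trans Phi0oo; apply: le_trans sum_le.
  rewrite le_eqVlt; apply/orP; left; apply/eqP/eq_eseriesr => k _.
  rewrite leb_shell; last by rewrite mulr_gt0// dyadic_gt0.
  rewrite -(fineK kfin) -/kap muleCA -!EFinM; congr (_ * _%:E).
  by rewrite /C exprMn; ring.
have afin k : a k \is a fin_num.
  rewrite ge0_fin_numE//.
  have sk0 : (0 < dyadic R k ^+ n.+1)%R by rewrite exprn_gt0// dyadic_gt0.
  suff : a k * (dyadic R k ^+ n.+1)%:E < +oo.
    by rewrite !ltey; apply: contra_neq => ->; rewrite gt0_mulye ?lte_fin.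
  apply: le_lt_trans sum_fin.
  apply: (@nneseries_ge_term _ (fun k => a k * (dyadic R k ^+ n.+1)%:E)) => i.
  by apply: mule_ge0 => //; rewrite lee_fin exprn_ge0// ltW// dyadic_gt0.
exists (fine \o a); split => [k||k y ky] /=.
- exact: fine_ge0.
- rewrite (eq_eseriesr (g := fun k => a k * (dyadic R k ^+ n.+1)%:E))// => k _.
  by rewrite EFinM fineK.
- rewrite -lee_fin fineK// /a le_max; apply/orP; right.
  apply: ereal_sup_ubound; exists y => //=.
  exact: le_trans ky (norm_le_enorm y).
Qed.

Lemma dilate_affine (phi : 'rV[R]_n.+1 -> R) (t : R) x y :
  dilate phi t (x - y)%R = (t ^- n.+1 * phi (t^-1 *: x + (- t^-1) *: y))%R.
Proof. by rewrite /dilate scalerBr scaleNr. Qed.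

Lemma measurable_dilate (phi : 'rV[R]_n.+1 -> R) (t : R) x : (0 < t)%R ->
  measurable_fun [set: space] phi ->
  measurable_fun [set: space] (fun y => dilate phi t (x - y)%R).
Proof.
move=> t0 mphi; rewrite (_ : (fun y => _) =
    fun y => (t ^- n.+1 * phi (t^-1 *: x + (- t^-1) *: y))%R); last first.
  by apply/funext => y; exact: dilate_affine.
apply: measurable_funM; first exact: measurable_cst.
have ti : (- t^-1 != 0)%R by rewrite oppr_eq0 invr_eq0 gt_eqF.
exact: (measurableT_comp mphi (measurable_affine (t^-1 *: x)%R ti)).
Qed.

(** On the shell of scale s_k the kernel is at most t^-(n+1) b_k, so the
    integral is at most a constant times the series of the b_k s_k^(n+1) A_k,
    where A_k is a mean of D over a cube of radius 2 t s_k. The tail of the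
    series is small because the means are bounded, the first terms because the
    means vanish as t tends to 0. *)
Lemma kernel_limit (phi : 'rV[R]_n.+1 -> R) (b : nat -> R) x
    (D : 'rV[R]_n.+1 -> \bar R) (M e : R) :
  (forall k, 0 <= b k)%R ->
  \sum_(0 <= k <oo) (b k * dyadic R k ^+ n.+1)%:E < +oo ->
  (forall k y, (dyadic R k <= `|y|)%R -> (`|phi y| <= b k)%R) ->
  measurable_fun [set: space] phi ->
  measurable_fun [set: space] D -> (forall y, 0 <= D y) -> D x = 0 ->
  vanishing_mean D x -> (0 <= M)%R ->
  (forall r : R, (0 < r)%R -> \int[leb]_(y in ball x r) D y <= (M * r ^+
      n.+1)%:E) ->
  (0 < e)%R -> exists2 d : R, (0 < d)%R & forall t : R, (0 < t)%R -> (t < d)%R ->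
    \int[leb]_y (`|dilate phi t (x - y)|%:E * D y) <= e%:E.
Proof.
move=> b0 boo phib mphi mD D0 Dx vD M0 DM e0.
set B := \sum_(_ <= k <oo) _ in boo.
pose w k := (b k * dyadic R k ^+ n.+1)%R.
have s0 k : (0 < dyadic R k ^+ n.+1)%R by rewrite exprn_gt0// dyadic_gt0.
have w0 k : 0 <= (w k)%:E by rewrite lee_fin mulr_ge0// ltW.
have B0 : 0 <= B by apply: nneseries_ge0 => k _ _; exact: w0.
have Bfin : B \is a fin_num by rewrite ge0_fin_numE.
pose K := (2 ^+ n.+1 : R)%R.
have K0 : (0 < K)%R by exact: exprn_gt0.
pose e1 := (e / 2 / (K * (fine B + 1)))%R.
have fB : (0 <= fine B)%R by exact: fine_ge0.
have e1_gt0 : (0 < e1)%R by rewrite !divr_gt0// mulr_gt0//; lra.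
pose e2 := (e / 2 / (K * (M + 1)))%R.
have e2_gt0 : (0 < e2)%R by rewrite !divr_gt0// mulr_gt0//; lra.
have [N tailN] := nneseries_small_tail w0 boo e2_gt0.
have [d0 d0_gt0 vd0] := vD _ e1_gt0.
pose smax := (\sum_(k < N) dyadic R k + 1)%R.
have smax0 : (0 < smax)%R.
  by rewrite ltr_pwDr// sumr_ge0// => k _; rewrite ltW// dyadic_gt0.
have smaxE (k : nat) : (k < N)%N -> (dyadic R k <= smax)%R.
  move=> kN; rewrite /smax (bigD1 (Ordinal kN))//= -addrA lerDl addr_ge0//
      sumr_ge0//.
  by move=> i _; rewrite ltW// dyadic_gt0.
exists (d0 / (2 * smax))%R; first by rewrite divr_gt0// mulr_gt0.
move=> t t0 td.
pose rad k := (2 * t * dyadic R k)%R.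
have rad0 k : (0 < rad k)%R by rewrite !mulr_gt0// dyadic_gt0.
have radN k : (k < N)%N -> (rad k < d0)%R.
  move=> kN; move: td; rewrite ltr_pdivlMr ?mulr_gt0//; apply: le_lt_trans.
  by rewrite /rad mulrCA mulrA ler_pM2l ?smaxE// mulr_gt0.
pose u k (y : space) := (t ^- n.+1 * b k)%:E * (D \_ (ball x (rad k))) y.
have tN0 : (0 < t ^- n.+1)%R by rewrite invr_gt0 exprn_gt0.
have tb0 k : (0 <= t ^- n.+1 * b k)%R by rewrite mulr_ge0// ltW.
have Dk0 k y : 0 <= (D \_ (ball x (rad k))) y.
  by rewrite patchE; case: ifP => // _; exact: lexx.
have u0 k y : 0 <= u k y by rewrite /u mule_ge0// lee_fin.
have mball k : measurable (ball x (rad k) : set space)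
    by exact: measurable_ball_space.
have mDk k : measurable_fun [set: space] (D \_ (ball x (rad k))).
  apply/(measurable_restrictT _ (mball k)); exact: measurable_funTS.
have mu k : measurable_fun [set: space] (u k).
  exact: measurable_funeM.
have iu k : \int[leb]_y u k y = (t ^- n.+1 * b k)%:E * \int[leb]_(y in ball x
    (rad k)) D y.
  rewrite [in RHS]integral_mkcond ge0_integralZl_EFin//.
have mdil : measurable_fun [set: space] (fun y => `|dilate phi t (x - y)|%:E * D y).
  apply: emeasurable_funM; last exact: mD.
  exact: (measurable_normr_EFin (measurable_dilate x t0 mphi)).
apply: (@le_trans _ _ (\int[leb]_y \sum_(0 <= k <oo) u k y)).
  apply: ge0_le_integral.
  - exact: measurableT.
  - by move=> y _; rewrite mule_ge0// lee_fin.
  - exact: mdil.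
  - exact: ge0_emeasurable_sum.
  - move=> y _; have [xy|xy] := eqVneq x y.
      by rewrite -xy Dx mule0; exact: nneseries_ge0.
    have rho0 : (0 < `|t^-1 *: (x - y)|)%R.
      by rewrite normr_gt0 scaler_eq0 subr_eq0 (negbTE xy) invr_eq0 gt_eqF.
    have [k /andP[k1 k2]] := dyadic_exists rho0.
    apply: le_trans (nneseries_ge_term k (fun k => u0 k y)).
    have yk : ball x (rad k) y.
      rewrite mx_norm_ball /ball_/=; move: k2.
      rewrite normrZ gtr0_norm ?invr_gt0// mulrC ltr_pdivrMr// => k2.
      by apply: lt_le_trans k2 _; rewrite /rad mulrAC.
    rewrite /u patchE mem_set//; apply: lee_wpmul2r => //.
    rewrite lee_fin /dilate normrM gtr0_norm// ler_pM2l//; exact: phib.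
rewrite integral_nneseries; last 3 first.
- exact: measurableT.
- exact: mu.
- by move=> k y _; exact: u0.
apply: (@le_trans _ _ (\sum_(0 <= k <oo) ((if (k < N)%N then K * e1 else K *
    M) * w k)%:E)).
  apply: lee_nneseries => k _; first by move=> _; apply: integral_ge0 => y _;
      exact: u0.
  rewrite iu.
  have -> : ((if (k < N)%N then K * e1 else K * M) * w k)%:E =
      (t ^- n.+1 * b k)%:E * ((if (k < N)%N then e1 else M) * rad k ^+ n.+1)%:E.
    rewrite -EFinM; congr _%:E.
    rewrite /rad /w !exprMn -/K;
        have tn0 : (t ^+ n.+1 != 0)%R by rewrite gt_eqF// exprn_gt0.
    by case: ifP => _; field.
  apply: lee_wpmul2l; first by rewrite lee_fin.
  by case: ifP => [kN|_]; [apply: vd0 => //; exact: radN|exact: DM].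
rewrite (@nneseries_split _ _ 0 N); last first.
  move=> k _; rewrite lee_fin mulr_ge0//; last exact: w0.
  by case: ifP => _; rewrite mulr_ge0// ltW.
rewrite add0n.
have -> : e%:E = (e / 2)%:E + (e / 2)%:E by rewrite -EFinD -splitr.
apply: leeD.
  apply: (@le_trans _ _ ((K * e1)%:E * B)).
    rewrite -[leRHS](@nneseriesZl _ _ xpredT (K * e1)%R 0 (fun k _ => w0 k)).
    rewrite (@nneseries_split _ (fun k => (K * e1)%:E * (w k)%:E) 0 N); last first.
      by move=> k _; rewrite mule_ge0// lee_fin mulr_ge0// ltW.
    rewrite add0n; apply: le_trans (leeDl _ _); last first.
      by apply: nneseries_ge0 => k _ _; rewrite mule_ge0// lee_fin mulr_ge0// ltW.
    rewrite big_nat [leRHS]big_nat; apply: lee_sum => k /andP[_ kN].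
    by rewrite kN EFinM.
  rewrite -(fineK Bfin) -EFinM lee_fin.
  have -> : (K * e1 * fine B = e / 2 * (fine B / (fine B + 1)))%R.
    by rewrite /e1; field; rewrite !gt_eqF//; lra.
  by rewrite ler_piMr ?ler_pdivrMr//; lra.
apply: (@le_trans _ _ ((K * M)%:E * e2%:E)).
  apply: (@le_trans _ _ ((K * M)%:E * \sum_(N <= k <oo) (w k)%:E)).
    rewrite -nneseriesZl//; rewrite le_eqVlt; apply/orP; left; apply/eqP.
    congr (limn _); apply/funext => m; apply: eq_big_nat => k /andP[Nk _].
    by rewrite ltnNge Nk/= EFinM.
  by apply: lee_wpmul2l; [rewrite lee_fin mulr_ge0// ltW|exact: ltW].
rewrite -EFinM lee_fin.
have -> : (K * M * e2 = e / 2 * (M / (M + 1)))%R.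
  by rewrite /e2; field; rewrite !gt_eqF//; lra.
by rewrite ler_piMr ?ler_pdivrMr//; lra.
Qed.

(** * Domination by the Luxemburg norms *)

Lemma lux_norm_ge0 (r f : 'rV[R]_n.+1 -> R) : 0 <= lux_norm r f.
Proof. by apply: le_ereal_inf_tmp => _ [l [l0 _] <-]; rewrite lee_fin ltW. Qed.

(** Summing the bounds for the single g_k, with levels l_k that exceed the
    Luxemburg norms by at most the terms of a convergent geometric series. *)
Lemma lux_norm_dominated (r : 'rV[R]_n.+1 -> R) (g : nat -> 'rV[R]_n.+1 -> R) :
  measurable_fun [set: space] r -> {ae leb, forall x, (1 <= r x)%R} ->
  (forall k, measurable_fun [set: space] (g k)) ->
  \sum_(0 <= k <oo) lux_norm r (g k) < +oo ->
  exists2 La : R, (0 <= La)%R & forall B : set space, measurable B ->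
    \int[leb]_(y in B) (\sum_(0 <= k <oo) `|g k y|%:E) <= La%:E * leb B + La%:E.
Proof.
move=> mr r1 mg goo.
have lux0 k : 0 <= lux_norm r (g k) by exact: lux_norm_ge0.
have luxfin k : lux_norm r (g k) \is a fin_num.
  rewrite ge0_fin_numE//; apply: le_lt_trans goo.
  exact: (nneseries_ge_term k lux0).
have /choice[l lP] k : exists l : R, [/\ (0 < l)%R,
    modular r (fun x => g k x / l)%R <= 1 &
    l%:E <= lux_norm r (g k) + (1 / (2 ^ k.+1)%:R)%:E].
  have e0 : (0 < 1 / (2 ^ k.+1)%:R :> R)%R by rewrite divr_gt0// ltr0n expn_gt0.
  have [_ [l [l0 l1] <-] lt_l] := lb_ereal_inf_adherent e0 (luxfin k).
  by exists l; split => //; exact: ltW.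
have l0 k : 0 <= (l k)%:E by have [l0 _ _] := lP k; rewrite lee_fin ltW.
set S := \sum_(0 <= k <oo) (l k)%:E.
have S0 : 0 <= S by apply: nneseries_ge0 => k _ _; exact: l0.
have Soo : S < +oo.
  apply: (@le_lt_trans _ _ (\sum_(0 <= k <oo) lux_norm r (g k) + 1%:E)); last first.
    by rewrite lte_add_pinfty// ltry.
  apply: le_trans (epsilon_trick xpredT lux0 ler01).
  by apply: lee_nneseries => k _; [move=> _; exact: l0|have [] := lP k].
have Sfin : S \is a fin_num by rewrite ge0_fin_numE.
exists (fine S); first exact: fine_ge0.
move=> B mB; rewrite fineK//.
rewrite integral_nneseries; last 3 first.
- exact: mB.
- by move=> k; apply: measurable_funTS; exact: measurable_normr_EFin.
- by move=> k y _; rewrite lee_fin.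
apply: (@le_trans _ _ (\sum_(0 <= k <oo) ((l k)%:E * leb B + (l k)%:E))).
  apply: lee_nneseries => k _; first by move=> _; apply: integral_ge0 => y _;
      rewrite lee_fin.
  have [lk0 lk1 _] := lP k.
  exact: (@integral_le_modular _ space R leb (g k) r (l k) B).
have mB0 : 0 <= leb B by exact: measure_ge0.
rewrite nneseriesD; last 2 first.
- by move=> k _ _; rewrite mule_ge0.
- by move=> k _ _; exact: l0.
rewrite leeD2r//.
(* when B has infinite measure, the positivity of l 0 makes the bound infinite *)
have [Boo|Bfin] := eqVneq (leb B) +oo.
  rewrite Boo gt0_muley ?leey//; apply: lt_le_trans (nneseries_ge_term 0 l0).
  by have [] := lP 0%N.
have Bf : leb B \is a fin_num by rewrite ge0_fin_numE// ltey.
rewrite -(fineK Bf) muleC -nneseriesZl//.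
by under eq_eseriesr do rewrite muleC.
Qed.

(** The real part of p/q is the quotient of the real parts: at infinite values
    of p or q both are 0, by the conventions on fine and on division. *)
Lemma measurable_fine_quot (p q : 'rV[R]_n.+1 -> \bar R) :
  measurable_fun [set: space] p -> measurable_fun [set: space] q ->
  (forall x, 1 <= p x) -> (forall x, 1 <= q x) ->
  measurable_fun [set: space] (fine \o quot_exp p q).
Proof.
move=> mp mq p1 q1.
have mfp : measurable_fun [set: space] (fine \o p).
  by apply: measurableT_comp mp; exact: fine_measurable.
have mfq : measurable_fun [set: space] (fine \o q).
  by apply: measurableT_comp mq; exact: fine_measurable.
rewrite (_ : _ \o _ = fun x => ((fine \o p) x * ((fine \o q) x) `^ (-1))%R).
  apply: measurable_funM; first exact: mfp.
  exact: (measurableT_comp (measurable_powR (-1)%R) mfq).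
apply/funext => x; have := p1 x; have := q1 x; rewrite /quot_exp/=.
case: (q x) => [b||]//; case: (p x) => [a||]//; rewrite ?lee_fin => b1 a1.
- have b0 : (b != 0)%R by rewrite gt_eqF//; lra.
  by rewrite inver (negbTE b0) -EFinM/= powR_inv1//; lra.
- have b0 : (0 < b)%R by lra.
  by rewrite inver gt_eqF// gt0_mulye ?lte_fin ?invr_gt0//= mul0r.
- by rewrite invey mule0/= powR0 ?mulr0// oppr_eq0 oner_eq0.
- by rewrite invey mule0/= mul0r.
Qed.

Lemma measurable_spow (q f : 'rV[R]_n.+1 -> R) :
  measurable_fun [set: space] q -> measurable_fun [set: space] f ->
  measurable_fun [set: space] (spow q f).
Proof.
move=> mq mf; apply: measurable_funM; first exact: mf.
apply: (@measurable_fun_powRR _ space R (fun x => `|f x|%R) (fun x => q x - 1)%R).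
  by apply: measurableT_comp mf; exact: normr_measurable.
by apply: measurable_funB; [exact: mq|exact: measurable_cst].
Qed.

(** The decay condition makes the exponent finite everywhere, so that its real
    part inherits the almost everywhere lower bound. *)
Lemma quot_exp_ge1 (p q : 'rV[R]_n.+1 -> \bar R) :
  1 < ess_inf leb (quot_exp p q) -> log_holder (quot_exp p q) ->
  {ae leb, forall x, (1 <= (fine \o quot_exp p q) x)%R}.
Proof.
move=> h1 [_ [Coo [roo hinf]]].
have := @ess_inf_le _ space R leb (quot_exp p q) => /ae_leb_imply; apply => x hx.
have {}h1 := lt_le_trans h1 hx; rewrite /= -lee_fin fineK; first exact: ltW.
rewrite fin_real//; apply/andP; split; first by apply: lt_trans h1; exact: ltNyr.
have := hinf x; case: (quot_exp p q x) => [s| |] //.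
by rewrite ltry.
Qed.

(** * Convolution at a Lebesgue point *)

Section convolution_bound.
Variables (phi : 'rV[R]_n.+1 -> R) (x : 'rV[R]_n.+1) (t : R).
Hypothesis aphi : approx_identity phi.
Hypothesis t0 : (0 < t)%R.

Let K (y : space) : R := dilate phi t (x - y)%R.

Lemma integral_dilate :
  leb.-integrable [set: space] (fun y => (K y)%:E) /\ \int[leb]_y (K y)%:E = 1.
Proof.
have [iphi phi1] := aphi.
have ti : (- t^-1 != 0)%R by rewrite oppr_eq0 invr_eq0 gt_eqF.
have [iT iTE] := integral_affine (t^-1 *: x)%R ti iphi.
have KE : (fun y => (K y)%:E) =
    fun y => (t ^- n.+1)%:E * (phi (t^-1 *: x + (- t^-1) *: y)%R)%:E.
  by apply/funext => y; rewrite /K dilate_affine EFinM.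
rewrite KE; split; first exact: (integrableZl measurableT _ iT).
rewrite (integralZl measurableT iT) iTE phi1 mule1 -EFinM.
rewrite normrN normfV gtr0_norm// exprVn invrK mulVf// gt_eqF// exprn_gt0//.
Qed.

(** As K has integral 1, subtracting h(x) can be done under the integral. *)
Lemma convol_sub_le (h : 'rV[R]_n.+1 -> R) :
  measurable_fun [set: space] h ->
  \int[leb]_y (`|K y * (h y - h x)|%:E) < +oo ->
  `|convol (dilate phi t) h x - (h x)%:E| <=
    \int[leb]_y (`|K y * (h y - h x)|%:E).
Proof.
move=> mh foo; have [iK K1] := integral_dilate.
have mK : measurable_fun [set: space] K.
  by apply/measurable_EFinP; exact: measurable_int iK.
have mKh : measurable_fun [set: space] (fun y => (K y * (h y - h x))%:E).
  apply/measurable_EFinP; apply: measurable_funM; first exact: mK.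
  by apply: measurable_funB; [exact: mh|exact: measurable_cst].
have iKh : leb.-integrable [set: space] (fun y => (K y * (h y - h x))%:E).
  by apply/integrableP; split; [exact: mKh|exact: foo].
have ihK : leb.-integrable [set: space] (fun y => (h x)%:E * (K y)%:E).
  exact: integrableZl.
have -> : convol (dilate phi t) h x =
    \int[leb]_y (K y * (h y - h x))%:E + (h x)%:E.
  rewrite -[X in _ = _ + X]mule1 -K1 -(integralZl measurableT iK).
  rewrite -(integralD measurableT iKh ihK).
  by apply: eq_integral => y _; rewrite /K -EFinM -EFinD; congr _%:E; ring.
rewrite addeK//; exact: (le_abse_integral leb measurableT mKh).
Qed.

End convolution_bound.

Lemma l2norm_convol_le (phi : 'rV[R]_n.+1 -> R) (g : nat -> 'rV[R]_n.+1 ->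
    R) x (t : R) :
  approx_identity phi -> (0 < t)%R ->
      (forall k, measurable_fun [set: space] (g k)) ->
  \int[leb]_y (`|dilate phi t (x - y)|%:E * l1_dist g (g ^~ x) y) < +oo ->
  l2norm (fun nu => convol (dilate phi t) (g nu) x - (g nu x)%:E) <=
  \int[leb]_y (`|dilate phi t (x - y)|%:E * l1_dist g (g ^~ x) y).
Proof.
move=> aphi t0 mg; have [iK _] := integral_dilate x aphi t0.
have mK : measurable_fun [set: space] (fun y => dilate phi t (x - y)%R).
  by apply/measurable_EFinP; exact: measurable_int iK.
have -> : \int[leb]_y (`|dilate phi t (x - y)|%:E * l1_dist g (g ^~ x) y) =
    \sum_(0 <= k <oo) \int[leb]_y (`|dilate phi t (x - y) * (g k y - g k x)|%:E).
  rewrite -integral_nneseries; last 3 first.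
  - exact: measurableT.
  - move=> k.
    have mk : measurable_fun [set: space]
        (fun y => (dilate phi t (x - y) * (g k y - g k x))%R).
      apply: measurable_funM; first exact: mK.
      by apply: measurable_funB; [exact: mg|exact: measurable_cst].
    exact: (measurable_normr_EFin mk).
  - by move=> k y _; rewrite lee_fin.
  apply: eq_integral => y _; rewrite -nneseriesZl; last by move=> k _;
      rewrite lee_fin.
  by apply: eq_eseriesr => k _; rewrite -EFinM -normrM.
move=> foo; apply: le_trans (l2norm_le_l1 _) _.
apply: lee_nneseries => k _; first by move=> _; exact: abse_ge0.
apply: convol_sub_le => //.
apply: le_lt_trans foo.
apply: (@nneseries_ge_term _ (fun k => \int[leb]_y (`|dilate phi t (x - y) *
    (g k y - g k x)|%:E))).
by move=> i; apply: integral_ge0 => y _; rewrite lee_fin.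
Qed.

(** For radii below some d the means are small by hypothesis; for larger
    radii the additive constant in the domination is absorbed by r^(n+1), which
    is at least d^(n+1). *)
Lemma l1_dist_mean_bound (g : nat -> 'rV[R]_n.+1 -> R) (La : R) x :
  (forall k, measurable_fun [set: space] (g k)) -> (0 <= La)%R ->
  (forall B : set space, measurable B ->
    \int[leb]_(y in B) (\sum_(0 <= k <oo) `|g k y|%:E) <= La%:E * leb B + La%:E) ->
  \sum_(0 <= k <oo) `|g k x|%:E < +oo ->
  vanishing_mean (l1_dist g (g ^~ x)) x ->
  exists2 M : R, (0 <= M)%R & forall r : R, (0 < r)%R ->
    \int[leb]_(y in ball x r) l1_dist g (g ^~ x) y <= (M * r ^+ n.+1)%:E.
Proof.
move=> mg La0 gLa Gx /(_ 1%R ltr01)[d d0 vd].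
set G := \sum_(_ <= k <oo) _ in Gx.
have G0 : 0 <= G by apply: nneseries_ge0 => k _ _; rewrite lee_fin.
have Gfin : G \is a fin_num by rewrite ge0_fin_numE.
have fG0 : (0 <= fine G)%R by exact: fine_ge0.
pose M1 := ((La + fine G) * 2 ^+ n.+1 + La / d ^+ n.+1)%R.
have M10 : (0 <= M1)%R.
  by rewrite addr_ge0// ?mulr_ge0 ?addr_ge0 ?exprn_ge0// invr_ge0 exprn_ge0// ltW.
exists (1 + M1)%R; first by rewrite addr_ge0.
move=> r r0; have [rd|dr] := ltP r d.
  apply: le_trans (vd r r0 rd) _; rewrite lee_fin ler_wpM2r ?exprn_ge0 ?(ltW r0)//.
  by rewrite lerDl.
have mB : measurable (ball x r : set space) by exact: measurable_ball_space.
have mD c : measurable_fun (ball x r : set space) (l1_dist g c).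
  by apply: measurable_funTS; exact: (@measurable_l1_dist _ space).
apply: (@le_trans _ _ (\int[leb]_(y in ball x r)
    (l1_dist g (fun=> 0%R) y + (fine G)%:E))).
  apply: ge0_le_integral.
  - exact: mB.
  - by move=> y _; exact: l1_dist_ge0.
  - exact: mD.
  - by apply: emeasurable_funD; [exact: mD|exact: measurable_cst].
  - move=> y _; apply: le_trans (l1_dist_triangle _ _ (fun=> 0%R) y) _.
    rewrite fineK// leeD2l// /G; apply: lee_nneseries => k _;
        last by rewrite sub0r normrN.
    by move=> _; rewrite lee_fin.
rewrite ge0_integralD; last 5 first.
- exact: mB.
- by move=> y _; exact: l1_dist_ge0.
- exact: mD.
- by move=> y _; rewrite lee_fin.
- exact: measurable_cst.
rewrite integral_cst; last exact: mB.
under eq_integral do rewrite l1_dist0.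
have lebB := leb_ball_le x r0.
apply: (@le_trans _ _ ((La * (2 * r) ^+ n.+1 + La)%:E + (fine G * (2 * r) ^+
    n.+1)%:E)).
  apply: leeD; last by rewrite EFinM; apply: lee_wpmul2l.
  apply: le_trans (gLa _ mB) _; rewrite EFinD leeD2r// EFinM.
  exact: lee_wpmul2l.
rewrite -EFinD lee_fin exprMn.
have rN : (La <= La / d ^+ n.+1 * r ^+ n.+1)%R.
  rewrite mulrAC -mulrA ler_peMr// ler_pdivlMr ?exprn_gt0// mul1r.
  by rewrite lerXn2r// nnegrE ltW.
have rn0 : (0 <= r ^+ n.+1)%R by rewrite exprn_ge0// ltW.
rewrite /M1; nra.
Qed.

End lebesgue_space.

Theorem theorem5p8 (R : realType) (n : nat) (p q : 'rV[R]_n.+1 -> \bar R)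
    (hp : exponent p) (hq : exponent q)
    (hp_sup : ess_sup leb p < +oo) (hq_sup : ess_sup leb q < +oo)
    (hpq_inf : 1 < ess_inf leb (quot_exp p q))
    (hpq_LH : log_holder (quot_exp p q))
    (phi : 'rV[R]_n.+1 -> R) (hphi : potential_type phi)
    (g : nat -> 'rV[R]_n.+1 -> R) (hg : spaceV p q g) :
  {ae leb, forall x : 'rV[R]_n.+1,
    l2norm (fun nu => convol (dilate phi t) (g nu) x - (g nu x)%:E)
      @[t --> (0 : R)%R^'+] --> 0}.
Proof.
have [leb0|leb0] := eqVneq (leb [set: leb_space R n]) 0.
  by exists setT; split => //.
have [aphi majphi] := hphi.
have [b [b0 boo phib]] := potential_shell_bound leb0 majphi.
have [[mp p1] [mq q1]] := (hp, hq).
have [f [fL gE] goo] := hg.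
have mfq : measurable_fun [set: leb_space R n] (fine \o q).
  by apply: measurableT_comp mq; exact: fine_measurable.
have mg k : measurable_fun [set: leb_space R n] (g k).
  by rewrite gE; apply: measurable_spow => //; have [] := fL k.
have mr := measurable_fine_quot mp mq p1 q1.
have r1 := quot_exp_ge1 hpq_inf hpq_LH.
have [La La0 gLa] := lux_norm_dominated mr r1 mg goo.
have gfin (B : set (leb_space R n)) : measurable B -> leb B < +oo ->
    \int[leb]_(y in B) (\sum_(0 <= k <oo) `|g k y|%:E) < +oo.
  move=> mB Boo; apply: le_lt_trans (gLa B mB) _.
  have Bfin : leb B \is a fin_num by rewrite ge0_fin_numE.
  by rewrite -(fineK Bfin) -EFinM -EFinD ltry.
apply: (ae_leb_imply (lebesgue_points mg gfin)) => x [Gx vx].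
have [M M0 DM] := l1_dist_mean_bound mg La0 gLa Gx vx.
have mphi : measurable_fun [set: leb_space R n] phi.
  by apply/measurable_EFinP; have [iphi _] := aphi; exact: measurable_int iphi.
apply: cvg_at_right0_ge0 => [t|e e0]; first exact: l2norm_ge0.
have mD := @measurable_l1_dist _ (leb_space R n) R g mg (g ^~ x).
have Dx : l1_dist g (g ^~ x) x = 0.
  by apply: eseries0 => k _ _; rewrite subrr normr0.
have [d d0 dle] := kernel_limit b0 boo phib mphi mD (l1_dist_ge0 _ _) Dx vx M0
    DM e0.
exists d => // t t0 td; apply: le_trans (dle t t0 td).
apply: l2norm_convol_le => //.
exact: le_lt_trans (dle t t0 td) (ltry _).
Qed.
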